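(* Let $T$ be a finite group, $n\in\mathbb{N}$, $\lambda=(\lambda^\zeta)_{\zeta\in\widehat{T}}\in\mathbb{Y}_n(\widehat{T})$ and $k\in\mathbb{N}=\{1,2,\dots\}$. Then $$M_k(\mathfrak{m}_{\lambda^\zeta})=\frac{(\dim\zeta)^{k-1}}{|T|^k}\sum_{\theta\in[T]}\frac{\chi^\lambda\bigl(\mathrm{E}[J_{n+1}^{\,k}(A_\theta,(n+1))]\bigr)}{\dim\lambda}\,\overline{\chi^\zeta_\theta},\qquad \zeta\in\widehat{T},$$ or equivalently (by inversion) $$\frac{\chi^\lambda\bigl(\mathrm{E}[J_{n+1}^{\,k}(A_\theta,(n+1))]\bigr)}{\dim\lambda}=|T|^{k-1}|C_\theta|\sum_{\zeta\in\widehat{T}}\frac{M_k(\mathfrak{m}_{\lambda^\zeta})\,\chi^\zeta_\theta}{(\dim\zeta)^{k-1}},\qquad \theta\in[T].$$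
   Context: $\mathfrak{S}_n(T)=T^n\rtimes\mathfrak{S}_n$ is the wreath product ($\mathfrak{S}_n$ permutes the coordinates of $T^n$), and $\mathfrak{S}_n(T)\subset\mathfrak{S}_{n+1}(T)$ via $T^n\cong T^n\times\{e_T\}\subset T^{n+1}$ and $\mathfrak{S}_n\subset\mathfrak{S}_{n+1}$. $[T]$ is the set of conjugacy classes of $T$; $C_\theta\subset T$ is the class labeled by $\theta\in[T]$. $\widehat{T}$ is the set of equivalence classes of irreducible complex representations of $T$, and $\chi^\zeta_\theta$ is the value of the (non-normalized) irreducible character of $\zeta\in\widehat T$ on $C_\theta$. $\mathbb{Y}$ is the set of Young diagrams (including $\varnothing$), $|\nu|$ the number of boxes of $\nu$. $\mathbb{Y}_n(\widehat{T})=\{(\lambda^\zeta)_{\zeta\in\widehat{T}}: \lambda^\zeta\in\mathbb{Y},\ \sum_\zeta|\lambda^\zeta|=n\}$ parametrizes the irreducible representations of $\mathfrak{S}_n(T)$: with $n_\zeta=|\lambda^\zeta|$, $\lambda$ corresponds to the representation induced from $\prod_\zeta\mathfrak{S}_{n_\zeta}(T)$ of $\boxtimes_\zeta(V_\zeta^{\otimes n_\zeta}\otimes S^{\lambda^\zeta})$, where $S^{\nu}$ is the irreducible representation of the symmetric group $\mathfrak S_{|\nu|}$ labeled by $\nu$ (one-row diagrams giving trivial representations). $\chi^\lambda$ is its character (non-normalized trace), extended linearly to $\mathbb{C}[\mathfrak{S}_n(T)]$, and $\dim\lambda$ its dimension. For $t\in T$, $(t,(i))$ denotes the element of $T^{n+1}$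 with $i$th entry $t$ and other entries $e_T$. The Jucys–Murphy element is $$J_{n+1}=\sum_{i=1}^n\sum_{y\in T}(y^{-1},(i))\,(y,(n+1))\,(i\ \ n+1)\in\mathbb{C}[\mathfrak{S}_{n+1}(T)],$$ and $(A_\theta,(n+1))=\sum_{x\in C_\theta}(x,(n+1))$. The restriction map $\mathrm{E}:\mathbb{C}[\mathfrak{S}_{n+1}(T)]\to\mathbb{C}[\mathfrak{S}_n(T)]$ is linear with $\mathrm{E}[g]=g$ for $g\in\mathfrak{S}_n(T)$ and $\mathrm{E}[g]=0$ for $g\in\mathfrak{S}_{n+1}(T)\setminus\mathfrak{S}_n(T)$. For $\nu\in\mathbb{Y}$, the content of a box in row $i$ and column $j$ is $j-i$. Let $x_1<\dots<x_r$ be the contents of the boxes that can be added to $\nu$ (to give a Young diagram) and $y_1<\dots<y_{r-1}$ the contents of the boxes that can be removed from $\nu$; then $x_1<y_1<x_2<\dots<y_{r-1}<x_r$. Kerov's transition measure $\mathfrak{m}_\nu$ is the probability measure supported on $\{x_1,\dots,x_r\}$ determined by $\frac{(z-y_1)\cdots(z-y_{r-1})}{(z-x_1)\cdots(z-x_r)}=\sum_{i=1}^r\frac{\mathfrak{m}_\nu(\{x_i\})}{z-x_i}$. $M_k(\mathfrak{m})$ denotes the $k$th moment of a probability measure $\mathfrak{m}$ on $\mathbb{R}$. *)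

(* Defs.v *)
From HB Require Import structures.
From mathcomp Require Import all_boot all_order all_fingroup all_algebra.
From mathcomp Require Import all_solvable all_field all_character finmap.
From mathcomp Require Import zify ring lra.

Set Implicit Arguments.
Unset Strict Implicit.
Unset Printing Implicit Defensive.

Import Order.TTheory GroupScope GRing.Theory Num.Theory.
Local Open Scope ring_scope.

(* A Young diagram is the weakly decreasing list of its positive row lengths.
   Rows and columns are numbered from 0, which does not affect contents. *)
Definition is_young (s : seq nat) := sorted geq s && (0%N \notin s).

Record young := Young {rows :> seq nat; rowsP : is_young rows}.

HB.instance Definition _ := [isSub for rows].
HB.instance Definition _ := [Choice of young by <:].

Definition boxes (nu : young) : nat := sumn nu.

(* Row i admits an extra box exactly when lengthening it leaves a weakly
   decreasing sequence; [incr_nth] creates the new row i = size nu. *)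
Definition addable_rows (nu : young) : seq nat :=
  [seq i <- iota 0 (size nu).+1 | sorted geq (incr_nth nu i)].

(* Shortening the last row may leave a trailing 0, i.e. remove that row. *)
Definition removable_rows (nu : young) : seq nat :=
  [seq i <- iota 0 (size nu) | sorted geq (set_nth 0%N nu i (nth 0%N nu i).-1)].

Definition addable_contents (nu : young) : seq int :=
  [seq (nth 0%N nu i)%:Z - i%:Z | i <- addable_rows nu].

Definition removable_contents (nu : young) : seq int :=
  [seq (nth 0%N nu i).-1%:Z - i%:Z | i <- removable_rows nu].

(* Finitely supported measures on the real line with integer atoms, given by
   the masses of their atoms. *)
Definition atomic_measure := {fsfun int -> algC with 0}.

Definition is_probability (m : atomic_measure) : Prop :=
  (forall x, 0 <= m x) /\ \sum_(x <- finsupp m) m x = 1.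

Definition moment (m : atomic_measure) (k : nat) : algC :=
  \sum_(x <- finsupp m) m x * x%:~R ^+ k.

Record is_transition_measure (nu : young) (m : atomic_measure) : Prop := {
  transition_probability : is_probability m;
  transition_support : {subset finsupp m <= addable_contents nu};
  transition_fraction : forall z : algC,
    (forall x, x \in addable_contents nu -> z != x%:~R) ->
    (\prod_(y <- removable_contents nu) (z - y%:~R))
      / (\prod_(x <- addable_contents nu) (z - x%:~R))
    = \sum_(x <- addable_contents nu) m x / (z - x%:~R) }.

(* x0 > y1 > x1 > y2 > x2 > ... for the list [:: (y1, x1); (y2, x2); ...]. *)
Fixpoint interlacing (x0 : int) (ps : seq (int * int)) : bool :=
  if ps is (y, x) :: ps' then [&& y < x0, x < y & interlacing x ps'] else true.

Lemma interlacing_lt x0 ps x :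
  interlacing x0 ps -> x \in unzip2 ps -> x < x0.
Proof.
elim: ps x0 => [|[y x1] ps IH] x0 //= /and3P[lt_y lt_x1 /IH {}IH].
have lt10 : x1 < x0 by apply: lt_trans lt_y.
by rewrite inE => /predU1P[->|/IH] // /lt_trans->.
Qed.

Lemma interlacing_uniq x0 ps : interlacing x0 ps -> uniq (x0 :: unzip2 ps).
Proof.
elim: ps x0 => [|[y x1] ps IH] x0 // il; rewrite cons_uniq.
apply/andP; split; last by case/and3P: il => _ _ /IH.
by apply/negP=> /(interlacing_lt il); rewrite ltxx.
Qed.

Lemma interlacing_fraction x0 ps : interlacing x0 ps ->
  exists w : int -> algC,
    [/\ forall x, x \in x0 :: unzip2 ps -> 0 <= w x,
        \sum_(x <- x0 :: unzip2 ps) w x = 1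
      & forall z : algC, (forall x, x \in x0 :: unzip2 ps -> z != x%:~R) ->
          (\prod_(y <- unzip1 ps) (z - y%:~R))
            / (\prod_(x <- x0 :: unzip2 ps) (z - x%:~R))
          = \sum_(x <- x0 :: unzip2 ps) w x / (z - x%:~R)].
Proof.
elim: ps x0 => [|[y x1] ps IH] x0.
  exists (fun=> 1); rewrite !big_seq1; split=> // z _.
  by rewrite !big_seq1 big_nil.
move=> il; have /and3P[lt_y lt_x1 /IH[w [w_ge0 w_sum w_frac]]] := il.
have lt_y1 x : x \in x1 :: unzip2 ps -> x < y.
  rewrite inE => /predU1P[->//|x_ps]; apply: lt_trans lt_x1.
  by apply: interlacing_lt x_ps; case/and3P: il.
have lt_10 x : x \in x1 :: unzip2 ps -> x < x0.
  by move/lt_y1/lt_trans; apply.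
have nz x : x \in x1 :: unzip2 ps -> x0%:~R - x%:~R != 0 :> algC.
  by move/lt_10=> lt_x; rewrite subr_eq0 eqr_int eq_sym lt_eqF.
pose c0 (x : int) := (x0%:~R - y%:~R) / (x0%:~R - x%:~R) : algC.
pose c1 (x : int) := (y%:~R - x%:~R) / (x0%:~R - x%:~R) : algC.
pose s0 := \sum_(x <- x1 :: unzip2 ps) w x * c0 x.
pose w' x := if x == x0 then s0 else w x * c1 x.
have w'E F : \sum_(x <- x1 :: unzip2 ps) w' x * F x
           = \sum_(x <- x1 :: unzip2 ps) w x * c1 x * F x :> algC.
  by apply: eq_big_seq => x /lt_10 lt_x; rewrite /w' lt_eqF.
have eq_w'0 : w' x0 = s0 by rewrite /w' eqxx.
exists w'; split.
- move=> x; rewrite inE; case/predU1P=> [->|x_ps].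
    rewrite eq_w'0 /s0 big_seq_cond sumr_ge0 // => x'; rewrite andbT => x'_ps.
    rewrite mulr_ge0 ?w_ge0 // divr_ge0 // subr_ge0 ler_int ltW //.
    exact: lt_10.
  rewrite /w' lt_eqF ?lt_10 // mulr_ge0 ?w_ge0 //.
  by rewrite divr_ge0 // subr_ge0 ler_int ltW // ?lt_10 ?lt_y1.
- rewrite [unzip2 _]/= big_cons eq_w'0.
  have -> : \sum_(x <- x1 :: unzip2 ps) w' x
          = \sum_(x <- x1 :: unzip2 ps) w x * c1 x.
    by apply: eq_big_seq => x /lt_10 lt_x; rewrite /w' lt_eqF.
  rewrite -big_split /= -[RHS]w_sum; apply: eq_big_seq => x x_ps.
  by rewrite -mulrDr -mulrDl addrA subrK mulfV ?nz // mulr1.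
move=> z z_n; rewrite [unzip1 _]/= [unzip2 _]/= big_cons 2!(big_cons _ _ x0).
rewrite /= eq_w'0 (w'E (fun x => (z - x%:~R)^-1)).
have z0 : z - x0%:~R != 0 by rewrite subr_eq0 z_n ?mem_head.
have zx x : x \in x1 :: unzip2 ps -> z - x%:~R != 0.
  by move=> x_ps; rewrite subr_eq0 z_n // inE x_ps orbT.
rewrite invfM mulrACA.
rewrite w_frac => [|x x_ps]; last by rewrite -subr_eq0 zx.
rewrite /s0 mulr_sumr mulr_suml -big_split; apply: eq_big_seq => x x_ps.
rewrite /c0 /c1 /=; have := nz x x_ps; have := zx x x_ps; move: z0.
by move=> *; field; apply/and3P.
Qed.

Lemma sorted_geqP (s : seq nat) :
  reflect (forall i, nth 0 s i.+1 <= nth 0 s i)%N (sorted geq s).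
Proof.
apply: (iffP (sortedP 0%N)) => s_dec i; last by move=> _; apply: s_dec.
have [/s_dec//|le_s] := ltnP i.+1 (size s).
by rewrite nth_default.
Qed.

Lemma removable_rowsE nu :
  removable_rows nu
  = [seq i <- iota 0 (size nu) | (nth 0 nu i.+1 < nth 0 nu i)%N].
Proof.
have /andP[/sorted_geqP nu_dec nu_pos] := rowsP nu.
apply: eq_in_filter => i; rewrite mem_iota /= => lt_i.
have: (0 < nth 0 nu i)%N.
  by rewrite lt0n; apply: contraNneq nu_pos => <-; apply: mem_nth.
move=> nu_i; apply/sorted_geqP/idP => [/(_ i)|lt_i1 j].
  by rewrite !nth_set_nth /= eqxx gtn_eqF // => le_i1; rewrite -(ltn_predK nu_i) ltnS.
rewrite !nth_set_nth /=; have := nu_dec j.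
have [<-|_] := eqVneq j.+1 i; first by rewrite ltn_eqF //; apply/leq_trans/leq_pred.
have [->|//] := eqVneq j i; lia.
Qed.

Lemma addable_rowsE nu : addable_rows nu = 0%N :: map S (removable_rows nu).
Proof.
have /andP[/sorted_geqP nu_dec _] := rowsP nu.
rewrite removable_rowsE /addable_rows -[(size nu).+1]add1n iotaD /=.
case: sorted_geqP => [_|[]]; last first.
  move=> i; rewrite !nth_incr_nth; have := nu_dec i.
  by case: i => [|i] /=; rewrite ?add0n // => /leqW.
congr (_ :: _); rewrite -[X in filter _ (iota X _)]addn0 iotaDl filter_map.
congr map; apply: eq_filter => i /=.
apply/sorted_geqP/idP => [/(_ i)|lt_i j]; rewrite !nth_incr_nth.
  by rewrite eqxx gtn_eqF // add1n add0n.
rewrite eqSS; have [<-|_] := eqVneq i j; first by rewrite gtn_eqF.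
by rewrite add0n; apply: leq_trans (nu_dec j) (leq_addl _ _).
Qed.

Lemma removable_interlacing (nu : young) a b n : (b <= a)%N ->
  interlacing ((nth 0%N nu b)%:Z - b%:Z)
    [seq ((nth 0%N nu i).-1%:Z - i%:Z, (nth 0%N nu i.+1)%:Z - i.+1%:Z)
    | i <- [seq i <- iota a n | (nth 0 nu i.+1 < nth 0 nu i)%N]].
Proof.
have /andP[/sorted_geqP nu_dec _] := rowsP nu.
elim: n a b => [|n IH] a b le_ba //=; case: ifP => [lt_a|_]; last exact/IH/leqW.
apply/and3P; split; [| lia | exact: IH].
have: (nth 0 nu a <= nth 0 nu b)%N.
  by rewrite -(subnKC le_ba); elim: (a - b)%N => [|d IHd]; rewrite ?addn0 // addnS
    (leq_trans (nu_dec _)).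
lia.
Qed.

Lemma transition_measure_exists nu : exists m, is_transition_measure nu m.
Proof.
pose ps := [seq ((nth 0%N nu i).-1%:Z - i%:Z, (nth 0%N nu i.+1)%:Z - i.+1%:Z)
           | i <- removable_rows nu].
have il : interlacing ((nth 0%N nu 0)%:Z - 0%:Z) ps.
  by rewrite /ps removable_rowsE removable_interlacing.
have defX : addable_contents nu = ((nth 0%N nu 0)%:Z - 0%:Z) :: unzip2 ps.
  by rewrite /addable_contents addable_rowsE /= /unzip2 -!map_comp.
have defY : removable_contents nu = unzip1 ps.
  by rewrite /unzip1 -map_comp.
have uX : uniq (addable_contents nu) by rewrite defX interlacing_uniq.
have [w []] := interlacing_fraction il; rewrite -defX -defY => w_ge0 w_sum w_frac.
pose m : atomic_measure := [fsfun x in seq_fset tt (addable_contents nu) => w x].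
have mE x : m x = if x \in addable_contents nu then w x else 0.
  by rewrite fsfunE seq_fsetE.
have supp : {subset finsupp m <= addable_contents nu}.
  by move=> x; rewrite mem_finsupp mE; case: ifP; rewrite ?eqxx.
exists m; split=> //.
  split=> [x|]; first by rewrite mE; case: ifP => // /w_ge0.
  rewrite -w_sum [RHS](bigID [in finsupp m]) /= [X in _ + X]big1_seq ?addr0.
    rewrite -[RHS]big_filter (perm_big [seq x <- addable_contents nu | x \in finsupp m]).
      apply: eq_big_seq => x; rewrite mem_filter => /andP[_ x_X].
      by rewrite mE x_X.
    apply: uniq_perm; rewrite ?fset_uniq ?filter_uniq // => x.
    by rewrite mem_filter andb_idr // => /supp.
  by move=> x /andP[+ x_X]; rewrite mem_finsupp mE x_X negbK => /eqP.
move=> z /w_frac->; apply: eq_big_seq => x x_X.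
by rewrite mE x_X.
Qed.

Section Specht.
Variable nu : young.
Local Notation m := (boxes nu).

(* The boxes of nu are numbered row by row; [reshape_index nu i] and
   [reshape_offset nu i] are the row and the column of box number i. *)
Definition row_stab : {set 'S_m} :=
  [set s : 'S_m | [forall i : 'I_m, reshape_index nu (s i) == reshape_index nu i]].

Definition col_stab : {set 'S_m} :=
  [set s : 'S_m | [forall i : 'I_m, reshape_offset nu (s i) == reshape_offset nu i]].

Definition young_symmetrizer : 'M[algC]_(gcard [set: 'S_m]) :=
  \sum_(p in row_stab) \sum_(q in col_stab)
    (-1) ^+ q *: regular_repr algC [set: 'S_m] (p * q)%g.

(* S^nu, as the right ideal of the group algebra generated by the Young
   symmetrizer: representations act on row vectors from the right. *)
Definition specht_repr :=
  submod_repr (cyclic_mx_module (regular_repr algC [set: 'S_m])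
                                (gring_row young_symmetrizer)).
End Specht.

Section Wreath.
Variables (T : finGroupType) (n : nat).

(* In MathComp (s * t) i = t (s i), so that [Wreath f s] stands for the element
   f s^-1 of T^n x| S_n with permutations composed from right to left. The
   correspondence is the identity on T^n and on transpositions. *)
Record wreath := Wreath {wbase : {ffun 'I_n -> T}; wtop : 'S_n}.

Definition wreath_pair w := (wbase w, wtop w).
Definition pair_wreath p := Wreath p.1 p.2.
Lemma wreath_pairK : cancel wreath_pair pair_wreath. Proof. by case. Qed.

HB.instance Definition _ := Finite.copy wreath (can_type wreath_pairK).

Definition wreath_one := Wreath [ffun=> 1%g] 1%g.
Definition wreath_mul u v :=
  Wreath [ffun i => wbase u i * wbase v (wtop u i)]%g (wtop u * wtop v)%g.
Definition wreath_inv u :=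
  Wreath [ffun i => (wbase u ((wtop u)^-1 i))^-1]%g (wtop u)^-1%g.

Lemma wreath_mulA : associative wreath_mul.
Proof.
move=> u v w; rewrite /wreath_mul /= mulgA; congr Wreath.
by apply/ffunP=> i; rewrite !ffunE permM mulgA.
Qed.

Lemma wreath_mul1 : left_id wreath_one wreath_mul.
Proof.
case=> f s; rewrite /wreath_mul /= mul1g; congr Wreath.
by apply/ffunP=> i; rewrite !ffunE perm1 mul1g.
Qed.

Lemma wreath_mulV : left_inverse wreath_one wreath_inv wreath_mul.
Proof.
case=> f s; rewrite /wreath_mul /wreath_one /= mulVg; congr Wreath.
by apply/ffunP=> i; rewrite !ffunE mulVg.
Qed.

HB.instance Definition _ :=
  Finite_isGroup.Build wreath wreath_mulA wreath_mul1 wreath_mulV.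

Lemma wtopM : {morph wtop : u v / (u * v)%g}. Proof. by []. Qed.
Canonical wtop_morphism := @Morphism _ _ [set: wreath] _ (in2W wtopM).

Definition wentry (t : T) (i : 'I_n) : wreath :=
  Wreath [ffun j => if j == i then t else 1%g] 1%g.

Definition wtransp (i j : 'I_n) : wreath := Wreath [ffun=> 1%g] (tperm i j).

End Wreath.

Definition wreath_incl (T : finGroupType) n (w : wreath T n) : wreath T n.+1 :=
  Wreath [ffun i => if unlift ord_max i is Some j then wbase w j else 1%g]
         (lift_perm ord_max ord_max (wtop w)).

Section GroupAlgebra.
Variables (T : finGroupType) (n : nat).

(* As in [mxrepresentation], the group algebra of G is the span of the matrices
   [regular_repr algC G g]; [gring_row] reads off the coefficients, and
   [chi.[A]%CF] is the linear extension of a class function chi. *)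
Definition walg := 'M[algC]_(gcard [set: wreath T n]).

Definition wdelta (w : wreath T n) : walg :=
  regular_repr algC [set: wreath T n] w.

Definition wcoef (A : walg) (w : wreath T n) : algC :=
  gring_row A 0 (gring_index [set: wreath T n] w).

End GroupAlgebra.

Section JucysMurphy.
Variables (T : finGroupType) (n : nat).

Definition wreath_restr (A : walg T n.+1) : walg T n :=
  \sum_(w : wreath T n) wcoef A (wreath_incl w) *: wdelta w.

Definition jucys_murphy : walg T n.+1 :=
  \sum_(i < n) \sum_(y : T)
    wdelta (wentry y^-1 (lift ord_max i) * wentry y ord_max
            * wtransp T (lift ord_max i) ord_max)%g.

Definition class_last (C : {set T}) : walg T n.+1 :=
  \sum_(x in C) wdelta (wentry x ord_max).

End JucysMurphy.

Section PullBack.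
Variables (gT rT : finGroupType) (f : {morphism [set: gT] >-> rT}).
Variables (d : nat) (rG : mx_representation algC [set: rT] d).

Lemma pull_mx_repr : mx_repr [set: gT] (fun x => rG (f x)).
Proof.
split=> [|x y _ _]; first by rewrite morph1 repr_mx1.
by rewrite morphM ?inE // repr_mxM ?inE.
Qed.

Definition pull_repr := MxRepresentation pull_mx_repr.
End PullBack.

Section TensorPower.
Variables (T : finGroupType) (d m : nat).
Variable V : mx_representation algC [set: T] d.

(* The m-th tensor power of V in the basis of pure tensors of basis vectors:
   [Wreath f s] acts on the i-th factor by f i and moves it to position s i. *)
Definition tpow_mx (w : wreath T m) : 'M[algC]_#|{ffun 'I_m -> 'I_d}| :=
  \matrix_(a, b)
    \prod_(i < m) V (wbase w i) ((enum_val a : {ffun 'I_m -> 'I_d}) i)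
                               ((enum_val b : {ffun 'I_m -> 'I_d}) (wtop w i)).

Lemma tpow_mx_repr : mx_repr [set: wreath T m] tpow_mx.
Proof.
split=> [|u v _ _]; apply/matrixP=> a b; rewrite !mxE.
  have [<-|neq_ab] := eqVneq a b.
    by rewrite big1 // => i _; rewrite ffunE perm1 repr_mx1 mxE eqxx.
  have [i neq_i] : exists i, (enum_val a : {ffun _ -> _}) i != (enum_val b : {ffun _ -> _}) i.
    apply/existsP; apply: contraR neq_ab; rewrite negb_exists => /forallP eq_ab.
    by apply/eqP/enum_val_inj/ffunP=> i; apply/eqP; have := eq_ab i; case: eqP.
  rewrite (bigD1 i) //= ffunE perm1 repr_mx1 mxE (negbTE neq_i).
  by rewrite mulr0n mul0r.
under [RHS]eq_bigr => c _.
  rewrite !mxE [X in _ * X](reindex_inj (@perm_inj _ (wtop u))) -big_split /=.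
  over.
rewrite (reindex_onto enum_rank enum_val); last by move=> c _; rewrite enum_valK.
under [RHS]eq_bigl => c do rewrite enum_rankK eqxx.
under [RHS]eq_bigr => c _ do rewrite enum_rankK.
rewrite (reindex_onto
  (fun c : {ffun 'I_m -> 'I_d} => [ffun j => c ((wtop u)^-1%g j)])
  (fun c : {ffun 'I_m -> 'I_d} => [ffun i => c (wtop u i)])) /=; last first.
  by move=> c _; apply/ffunP=> i; rewrite !ffunE permKV.
transitivity (\prod_i \sum_(x < d) V (wbase u i) (enum_val a i) x
   * V (wbase v (wtop u i)) x (enum_val b (wtop v (wtop u i)))).
  by apply: eq_bigr => i _; rewrite ffunE permM repr_mxM ?inE // mxE.
rewrite bigA_distr_bigA /=; apply: eq_big => [c|c _].
  by apply/esym/eqP/ffunP=> i; rewrite !ffunE permK.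
by apply: eq_bigr => i _; rewrite ffunE permK.
Qed.

Definition tpow_repr := MxRepresentation tpow_mx_repr.
End TensorPower.

Definition block_repr (T : finGroupType) (zeta : Iirr [set: T]) (nu : young) :=
  prod_repr (tpow_repr (boxes nu) 'Chi_zeta)
            (pull_repr (wtop_morphism T (boxes nu)) (specht_repr nu)).

Record multidiagram (T : finGroupType) (n : nat) := Multidiagram {
  diagram :> Iirr [set: T] -> young;
  diagram_boxes : (\sum_z boxes (diagram z))%N = n }.

Section WreathChar.
Variables (T : finGroupType) (n : nat) (lam : multidiagram T n).

Definition block_prod : finGroupType :=
  {dffun forall z : Iirr [set: T], wreath T (boxes (lam z))}.

(* 'I_n is cut into consecutive intervals indexed by z; [block_of i] is the
   interval containing i together with the position of i inside it. *)
Definition block_pos : Type := {z : Iirr [set: T] & 'I_(boxes (lam z))}.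
Definition block_of (i : 'I_n) : block_pos :=
  tagnat.sig (cast_ord (esym (diagram_boxes lam)) i).
Definition of_block (p : block_pos) : 'I_n :=
  cast_ord (diagram_boxes lam) (tagnat.rank p).

Lemma block_ofK : cancel block_of of_block.
Proof. by move=> i; rewrite /of_block tagnat.sigK cast_ordKV. Qed.

Lemma of_blockK : cancel of_block block_of.
Proof. by move=> p; rewrite /block_of cast_ordK tagnat.rankK. Qed.

Definition block_move (w : block_prod) (p : block_pos) : block_pos :=
  Tagged (fun z => 'I_(boxes (lam z))) (wtop (w (tag p)) (tagged p)).

Lemma block_top_subproof w : injective (of_block \o block_move w \o block_of).
Proof.
apply: inj_comp (can_inj block_ofK); apply: inj_comp (can_inj of_blockK) _.
move=> [z i] [z' i'] eq_m; have eq_z : z = z' by apply: (congr1 tag eq_m).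
case: z' / eq_z i' eq_m => i' /eqP; rewrite eq_Tagged => /eqP/perm_inj /= eq_i.
by rewrite eq_i.
Qed.

Definition block_emb (w : block_prod) : wreath T n :=
  Wreath [ffun i => wbase (w (tag (block_of i))) (tagged (block_of i))]
         (perm (@block_top_subproof w)).

Lemma block_embM : {morph block_emb : u v / (u * v)%g}.
Proof.
move=> u v; congr Wreath.
  by apply/ffunP=> i; rewrite !ffunE permE /= of_blockK.
by apply/permP=> i; rewrite permM !permE /= of_blockK /block_move ffunE permM.
Qed.
Canonical block_emb_morphism :=
  @Morphism _ _ [set: block_prod] _ (in2W block_embM).

Lemma block_emb_inj : injective block_emb.
Proof.
move=> u v [/ffunP eq_b /permP eq_t]; apply/ffunP=> z.
case Du: (u z) => [f s]; case Dv: (v z) => [g t]; congr Wreath.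
  apply/ffunP=> i; have := eq_b (of_block (Tagged (fun z => 'I_(boxes (lam z))) i)).
  by rewrite !ffunE of_blockK /= Du Dv.
apply/permP=> i; have := eq_t (of_block (Tagged (fun z => 'I_(boxes (lam z))) i)).
rewrite !permE /= of_blockK => /(can_inj of_blockK)/eqP.
by rewrite /block_move eq_Tagged /= Du Dv => /eqP.
Qed.

Lemma block_emb_isom :
  isom [set: block_prod] (block_emb @* [set: block_prod]) block_emb.
Proof. by apply: sub_isom => //; apply/injmP=> u v _ _; apply: block_emb_inj. Qed.

Definition block_char : 'CF([set: block_prod]) :=
  \prod_z cfRepr
    (pull_repr (@dffun_morphism _ (fun z => wreath T (boxes (lam z))) z)
               (block_repr z (lam z))).

Definition wreath_char : 'CF([set: wreath T n]) :=
  'Ind[[set: wreath T n]] (cfIsom block_emb_isom block_char).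

End WreathChar.

(* Main.v *)
From HB Require Import structures.
Require Import Defs.
From mathcomp Require Import all_boot all_order all_fingroup all_algebra.
From mathcomp Require Import all_solvable all_field all_character finmap.
From mathcomp Require Import zify ring.

Set Implicit Arguments.
Unset Strict Implicit.
Unset Printing Implicit Defensive.

Import Order.TTheory GroupScope GRing.Theory Num.Theory.
Local Open Scope ring_scope.

(** The k-th power of the Jucys-Murphy element J times the class sum of C at the
    last point is restricted to the smaller wreath product, which makes it a class
    function Z there. Pairing Z with the induced character chi^lambda amounts to
    pairing its restriction to the block group, the product over zeta of the wreath
    products of T with the symmetric groups on |lambda^zeta| points, with the
    inducing character (cfInd_sum). The latter is a product of characters of tensor
    powers and of Specht characters.

    Specht characters. Let x and y be the row symmetrizer and the column
    antisymmetrizer of a diagram nu. By von Neumann's lemma x a y is a multiple of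
    x y for every a (row_col_sum_primitive), so a class sum multiplies the Young
    symmetrizer by a scalar, and the normalized Specht character is the class
    average of the coefficients of the Young symmetrizer (specht_class_average).
    Since Z is a class function, these coefficients may replace the characters
    (block_average).

    Tensor powers. Replacing the coefficient at the identity of the last copy of T
    by an average of traces over all irreducible eta placed at the last point
    (wreath_trace_restr) makes the whole expression a trace on tensors. There the sum
    over y in T of a term of J, by Schur orthogonality, is |T| / dim eta times the
    identity when the two points have the same type eta, and zero otherwise
    (wreath_coef_jm): the flip of the tensor factors by Schur's lemma cancels the one
    by the transposition. Only the permutations remain, and J becomes the
    Jucys-Murphy element of the symmetric group of the block of eta. The other
    factors are the class sum, which gives |C| chi^eta(C), and the number
      coefficient at 1 of x J^k y
    for nu = lambda^eta and J the ordinary Jucys-Murphy element of |nu| + 1 points.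

    Moments. This number is the k-th moment of the transition measure of nu
    (jucys_moment_transition). Remove the last box of nu, of content c. The
    Jucys-Murphy element of this box acts between x and y as c (row_jucysX_col),
    because it is half the difference of two central sums of transpositions, up to a
    constant. With the Hecke relation this yields that the generating series of the
    numbers above is divided by 1 - w^2 / (1 - c w)^2 when the box is added
    (moment_series_rec). The resulting product over all boxes telescopes along the
    rows to the product of 1 - y w over removable contents divided by the product of
    1 - x w over addable contents (transition_box_prod), which is the generating
    series of the moments of Kerov's measure (transition_series).

    Summing over eta gives the second formula, and the first one follows by
    orthogonality of the irreducible characters of T. *)

(** * Group algebras *)

Section GroupAlgebraSpan.
Variable gT : finGroupType.
Local Notation galg := 'M[algC]_(gcard [set: gT]).
Implicit Types (a b : galg) (g h : gT).

Definition gdelta g : galg := regular_repr algC [set: gT] g.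

Definition gcoef g a : algC := gring_row a 0 (gring_index [set: gT] g).

Lemma gdeltaM g h : gdelta (g * h)%g = gdelta g * gdelta h.
Proof. by rewrite /gdelta repr_mxM ?inE. Qed.

Lemma gdelta1 : gdelta 1%g = 1.
Proof. by rewrite /gdelta repr_mx1. Qed.

Lemma galg_scalel (x : algC) a b : (x *: a) * b = x *: (a * b).
Proof. by rewrite -!mulmxE scalemxAl. Qed.

Lemma galg_scaler (x : algC) a b : a * (x *: b) = x *: (a * b).
Proof. by rewrite -!mulmxE scalemxAr. Qed.

Lemma gcoef_is_linear g : linear_for *%R (gcoef g).
Proof. by move=> x a b; rewrite /gcoef linearP !mxE. Qed.

HB.instance Definition _ g :=
  GRing.isLinear.Build algC galg algC *%R (gcoef g) (gcoef_is_linear g).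

Lemma gcoef_delta g h : gcoef h (gdelta g) = (g == h)%:R.
Proof.
rewrite /gcoef /gring_row rowK !mxE /= gring_indexK ?inE // mul1g eq_sym.
by rewrite (inj_in_eq (can_in_inj (@gring_indexK _ [set: gT]%G))) ?inE.
Qed.

(** Identities between linear functions on the group algebra of S are proved
    on the elements of S alone, by induction on this predicate. *)
Inductive gspan (S : {set gT}) : galg -> Prop :=
| gspan0 : gspan S 0
| gspan_cons x g a : g \in S -> gspan S a -> gspan S (x *: gdelta g + a).

Lemma gspan_delta (S : {set gT}) g : g \in S -> gspan S (gdelta g).
Proof.
move=> Sg; rewrite -[gdelta g]addr0 -[gdelta g]scale1r.
exact: gspan_cons (gspan0 S).
Qed.

Lemma gspanD (S : {set gT}) a b : gspan S a -> gspan S b -> gspan S (a + b).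
Proof.
move=> Sa Sb; elim: Sa => [|x g {}a Sg _ IH]; first by rewrite add0r.
by rewrite -addrA; apply: gspan_cons.
Qed.

Lemma gspanZ (S : {set gT}) x a : gspan S a -> gspan S (x *: a).
Proof.
elim=> [|y g {}a Sg _ IH]; first by rewrite scaler0; apply: gspan0.
by rewrite scalerDr scalerA; apply: gspan_cons.
Qed.

Lemma gspan_sum (S : {set gT}) (I : Type) (r : seq I) (P : pred I) F :
  (forall i, P i -> gspan S (F i)) -> gspan S (\sum_(i <- r | P i) F i).
Proof.
by move=> SF; apply: big_ind SF => //; [apply: gspan0 | apply: gspanD].
Qed.

Lemma gspanM (G : {group gT}) a b : gspan G a -> gspan G b -> gspan G (a * b).
Proof.
move=> Ga; elim=> [|x g {}b Gg _ IH]; first by rewrite mulr0; apply: gspan0.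
rewrite mulrDr galg_scaler; apply: gspanD => //; apply: gspanZ.
elim: Ga => [|y h {}a Gh _ {}IH]; first by rewrite mul0r; apply: gspan0.
rewrite mulrDl galg_scalel -gdeltaM; apply: gspan_cons => //.
by rewrite groupM.
Qed.

Lemma gspan1 (G : {group gT}) : gspan G 1.
Proof. by rewrite -gdelta1; apply/gspan_delta/group1. Qed.

Lemma gspanX (G : {group gT}) a k : gspan G a -> gspan G (a ^+ k).
Proof.
by move=> Ga; elim: k => [|k IH]; rewrite ?expr0 ?exprS; [apply: gspan1 | apply: gspanM].
Qed.

Lemma gspan_subset (S S' : {set gT}) a :
  S \subset S' -> gspan S a -> gspan S' a.
Proof.
move/subsetP=> sSS'; elim=> [|x g {}a Sg _ IH]; first exact: gspan0.
by apply: gspan_cons => //; apply: sSS'.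
Qed.

Lemma gspan_comm (S : {set gT}) a b : gspan S a ->
  (forall g, g \in S -> GRing.comm b (gdelta g)) -> GRing.comm b a.
Proof.
move=> Sa cb; elim: Sa => [|x g {}a Sg _ IH]; first exact: commr0.
apply: commrD => //; rewrite /GRing.comm galg_scaler galg_scalel.
by rewrite cb.
Qed.

End GroupAlgebraSpan.

(** * Young symmetrizers of the initial segments of a standard tableau *)

(** Box number i of a standard tableau lies in row r i and column c i. The last
    two conditions say that every initial segment of boxes is a Young diagram. *)
Record standard_filling (r c : nat -> nat) (M : nat) : Prop := {
  filling_inj : forall i j, (i < M)%N -> (j < M)%N ->
    r i = r j -> c i = c j -> i = j;
  filling_row : forall i k, (i < M)%N -> (k < c i)%N ->
    exists2 i', (i' < i)%N & r i' = r i /\ c i' = k;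
  filling_col : forall i k, (i < M)%N -> (k < r i)%N ->
    exists2 i', (i' < i)%N & c i' = c i /\ r i' = k }.

Section LabelStabilizer.
Variable N : nat.
Implicit Types (s p q : 'S_N) (l : nat -> nat).

Definition initial_sym (j : nat) : {set 'S_N} :=
  [set s : 'S_N | [forall i : 'I_N, (j <= i)%N ==> (s i == i)]].

Lemma initial_symP j s :
  reflect (forall i : 'I_N, (j <= i)%N -> s i = i) (s \in initial_sym j).
Proof.
rewrite inE; apply: (iffP forallP) => fix_s i; first by move/(implyP (fix_s i))/eqP.
by apply/implyP=> le_ji; apply/eqP/fix_s.
Qed.

Lemma initial_sym_group_set j : group_set (initial_sym j).
Proof.
apply/group_setP; split=> [|s t /initial_symP sP /initial_symP tP].
  by apply/initial_symP=> i _; rewrite perm1.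
by apply/initial_symP=> i le_ji; rewrite permM sP ?tP.
Qed.
Canonical initial_sym_group j := Group (initial_sym_group_set j).

Lemma initial_symS j k : (j <= k)%N -> initial_sym j \subset initial_sym k.
Proof.
move=> le_jk; apply/subsetP=> s /initial_symP sP; apply/initial_symP=> i le_ki.
by apply: sP; apply: leq_trans le_ki.
Qed.

Lemma initial_sym_lt j s (i : 'I_N) :
  s \in initial_sym j -> (s i < j)%N = (i < j)%N.
Proof.
move/initial_symP=> sP; case: (ltnP i j) => [lt_ij|le_ji]; last first.
  by rewrite sP // ltnNge le_ji.
rewrite ltnNge; apply/negP=> le_jsi; have /perm_inj eq_s := sP _ le_jsi.
by move: le_jsi; rewrite eq_s leqNgt lt_ij.
Qed.

Lemma tperm_initial_sym j (u v : 'I_N) :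
  (u < j)%N -> (v < j)%N -> tperm u v \in initial_sym j.
Proof.
move=> lt_u lt_v; apply/initial_symP=> i le_ji.
by rewrite tpermD // -val_eqE /=; apply: contraTneq le_ji => <-; rewrite -ltnNge.
Qed.

Definition label_stab l j : {set 'S_N} :=
  [set s in initial_sym j | [forall i : 'I_N, l (s i) == l i]].

Lemma label_stabP l j s :
  reflect (s \in initial_sym j /\ forall i : 'I_N, l (s i) = l i)
          (s \in label_stab l j).
Proof.
apply: (iffP setIdP) => -[-> H]; split=> //.
  by move=> i; apply/eqP/(forallP H).
by apply/forallP=> i; apply/eqP.
Qed.

Lemma label_stab_group_set l j : group_set (label_stab l j).
Proof.
apply/group_setP; split=> [|s t /label_stabP[sG sl] /label_stabP[tG tl]].
  by apply/label_stabP; split=> [|i]; rewrite ?group1 ?perm1.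
by apply/label_stabP; split=> [|i]; rewrite ?groupM // permM tl.
Qed.
Canonical label_stab_group l j := Group (label_stab_group_set l j).

Lemma label_stab_sub l j : label_stab l j \subset initial_sym j.
Proof. by apply/subsetP=> s /label_stabP[]. Qed.

Lemma tperm_label_stab l j (u v : 'I_N) :
  (u < j)%N -> (v < j)%N -> l u = l v -> tperm u v \in label_stab l j.
Proof.
move=> lt_u lt_v luv; apply/label_stabP; split=> [|i]; first exact: tperm_initial_sym.
by case: tpermP => [->|->|].
Qed.

Lemma label_stabSE l (j : 'I_N) s :
  (s \in label_stab l j) = (s \in label_stab l j.+1) && (s j == j).
Proof.
apply/label_stabP/andP => [[sG sl]|[/label_stabP[/initial_symP sG sl] /eqP sj]].
  split; last by apply/eqP; move/initial_symP: sG; apply.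
  apply/label_stabP; split=> //; apply: (subsetP (initial_symS _)) sG.
  exact: leqnSn.
split=> //; apply/initial_symP=> i; rewrite leq_eqVlt => /predU1P[eq_ji|/sG//].
by rewrite -(val_inj eq_ji).
Qed.

(** The row symmetrizer (e = false) or the column antisymmetrizer (e = true)
    when l is the row or the column of a box. *)
Definition label_sum l j (e : bool) : 'M[algC]_(gcard [set: 'S_N]) :=
  \sum_(s in label_stab l j) (-1) ^+ (e && odd_perm s) *: gdelta s.

Definition label_step l (j : 'I_N) (e : bool) : 'M[algC]_(gcard [set: 'S_N]) :=
  \sum_(i : 'I_N | (i < j)%N && (l i == l j)) (-1) ^+ e *: gdelta (tperm i j).

Lemma label_sum_span l j e : gspan (initial_sym j) (label_sum l j e).
Proof.
apply: gspan_sum => s /(subsetP (label_stab_sub _ _)) sG.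
exact/gspanZ/gspan_delta.
Qed.

Lemma label_step_cosets l (j : 'I_N) e :
  1 + label_step l j e = \sum_(i : 'I_N | (i <= j)%N && (l i == l j))
     (-1) ^+ (e && (i != j)) *: gdelta (tperm i j).
Proof.
rewrite (bigD1 j) /=; last by rewrite leqnn eqxx.
rewrite eqxx andbF scale1r tperm1 gdelta1; congr (_ + _).
apply: eq_big => [i|i /andP[lt_ij _]].
  by rewrite ltn_neqAle val_eqE -andbA andbC.
have -> : (i != j) by rewrite -val_eqE /= ltn_eqF.
by rewrite andbT.
Qed.

Let signM (e a b : bool) :
  (-1) ^+ (e && (a (+) b)) = (-1) ^+ (e && a) * (-1) ^+ (e && b) :> algC.
Proof. by case: e; rewrite ?mulr1 //= signr_addb. Qed.

(** The permutation s of the first j + 1 points factors through the transposition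
    that brings j back from s j, and the other factor fixes j. *)
Lemma label_sumSr l (j : 'I_N) e :
  label_sum l j.+1 e = label_sum l j e * (1 + label_step l j e).
Proof.
rewrite label_step_cosets mulr_sumr /label_sum.
rewrite (partition_big (fun s : 'S_N => s j)
   (fun i : 'I_N => (i <= j)%N && (l i == l j))) /=; last first.
  move=> s /label_stabP[sG sl]; rewrite sl eqxx andbT -ltnS.
  by rewrite (initial_sym_lt _ sG) ltnSn.
apply: eq_bigr => i /andP[le_ij /eqP lij].
have tS : tperm i j \in label_stab l j.+1 by apply: tperm_label_stab.
rewrite (reindex_onto (fun p => p * tperm i j)%g (fun s => s * tperm i j)%g) /=; last first.
  by move=> s _; rewrite -mulgA tperm2 mulg1.
rewrite mulr_suml; apply: eq_big => [p|p _].
  rewrite -mulgA tperm2 mulg1 eqxx andbT permM groupMr // label_stabSE.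
  by congr (_ && _); rewrite -[X in _ == X](tpermR i j) (inj_eq perm_inj).
rewrite odd_permM odd_tperm signM gdeltaM galg_scaler galg_scalel scalerA.
by rewrite mulrC.
Qed.

Lemma label_sumSl l (j : 'I_N) e :
  label_sum l j.+1 e = (1 + label_step l j e) * label_sum l j e.
Proof.
rewrite label_step_cosets mulr_suml /label_sum.
rewrite (partition_big (fun s : 'S_N => s^-1%g j)
   (fun i : 'I_N => (i <= j)%N && (l i == l j))) /=; last first.
  move=> s; rewrite -groupV => /label_stabP[sG sl]; rewrite sl eqxx andbT -ltnS.
  by rewrite (initial_sym_lt _ sG) ltnSn.
apply: eq_bigr => i /andP[le_ij /eqP lij].
have tS : tperm i j \in label_stab l j.+1 by apply: tperm_label_stab.
rewrite (reindex_onto (fun p => tperm i j * p)%g (fun s => tperm i j * s)%g) /=; last first.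
  by move=> s _; rewrite mulgA tperm2 mul1g.
rewrite mulr_sumr; apply: eq_big => [p|p _].
  rewrite mulgA tperm2 mul1g eqxx andbT invMg permM groupMl // label_stabSE.
  rewrite tpermV; congr (_ && _).
  rewrite -[X in _ == X](tpermR i j) (inj_eq perm_inj).
  by rewrite (canF_eq (permKV p)) eq_sym.
rewrite odd_permM odd_tperm signM gdeltaM galg_scaler galg_scalel scalerA.
by rewrite mulrC.
Qed.

Lemma label_sum_mull l j e p : p \in label_stab l j ->
  gdelta p * label_sum l j e = (-1) ^+ (e && odd_perm p) *: label_sum l j e.
Proof.
move=> pG; rewrite /label_sum scaler_sumr mulr_sumr.
rewrite [RHS](reindex_inj (mulgI p)) /=.
apply: eq_big => [s|s _]; first by rewrite groupMl.
rewrite odd_permM signM scalerA galg_scaler gdeltaM mulrA -exprD.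
by rewrite addnn -muln2 mulnC exprM sqrrN !expr1n mul1r.
Qed.

Lemma label_sum_mulr l j e p : p \in label_stab l j ->
  label_sum l j e * gdelta p = (-1) ^+ (e && odd_perm p) *: label_sum l j e.
Proof.
move=> pG; rewrite /label_sum scaler_sumr mulr_suml.
rewrite [RHS](reindex_inj (mulIg p)) /=.
apply: eq_big => [s|s _]; first by rewrite groupMr.
rewrite odd_permM signM scalerA galg_scalel gdeltaM mulrCA -exprD.
by rewrite addnn -muln2 mulnC exprM sqrrN !expr1n mulr1.
Qed.

End LabelStabilizer.

Section VonNeumann.
Variables (N M : nat) (r c : nat -> nat).
Hypothesis fill : standard_filling r c M.
Implicit Types s : 'S_N.
Local Notation row_sum j := (label_sum N r j false).
Local Notation col_sum j := (label_sum N c j true).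

(** If no two boxes of a row go to the same column, every box u must go to a
    column that meets the row of u. Otherwise take a column C missed by row u0:
    the boxes that go to a column before C map injectively, inside rows, to
    the boxes lying before column C; both sets have the same cardinal, but the
    image misses u0. *)
Lemma dispersed_row j s (u0 : 'I_N) : (j <= M)%N -> s \in initial_sym N j ->
    (forall u v : 'I_N, (u < j)%N -> (v < j)%N -> r u = r v ->
        c (s u) = c (s v) -> u = v) ->
    (u0 < j)%N ->
  exists2 w : 'I_N, (w < j)%N & r w = r u0 /\ c w = c (s u0).
Proof.
move=> le_jM sG s_inj lt_u0.
case: (pickP [pred w : 'I_N | [&& (w < j)%N, r w == r u0 & c w == c (s u0)]]).
  by move=> w /and3P[lt_w /eqP rw /eqP cw]; exists w.
move=> no_w; set C := c (s u0).
have lt_M (u : 'I_N) : (u < j)%N -> (u < M)%N by move/leq_trans; apply.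
pose cell (u w : 'I_N) := [&& (w < j)%N, r w == r u & c w == c (s u)].
pose long (u : 'I_N) := [exists w : 'I_N, [&& (w < j)%N, r w == r u & (C <= c w)%N]].
pose f u := if long u then odflt u [pick w | cell u w] else u.
pose A := [set u : 'I_N | (u < j)%N && (c (s u) < C)%N].
pose B := [set u : 'I_N | (u < j)%N && (c u < C)%N].
have short_lt (u : 'I_N) : (u < j)%N -> ~~ long u -> (c u < C)%N.
  move=> lt_u; rewrite ltnNge; apply: contra => le_C; apply/existsP; exists u.
  by rewrite lt_u eqxx.
have short_u0 : ~~ long u0.
  apply/existsP=> -[w /and3P[lt_w /eqP rw]]; rewrite leq_eqVlt => /predU1P[Cw|lt_Cw].
    by have := no_w w; rewrite /= lt_w rw -Cw !eqxx.
  have [i lt_i [ri ci]] := filling_row fill (lt_M _ lt_w) lt_Cw.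
  have := no_w (Ordinal (ltn_trans lt_i (ltn_ord w))).
  by rewrite /= (ltn_trans lt_i lt_w) ri rw ci !eqxx.
have fP u : u \in A -> [/\ f u \in B, r (f u) = r u
    & if long u then c (f u) = c (s u) else f u = u].
  rewrite inE => /andP[lt_u lt_c]; rewrite /f.
  case: ifPn => [/existsP[w /and3P[lt_w /eqP rw le_C]]|short]; last first.
    by split=> //; rewrite inE lt_u short_lt.
  case: pickP => [w' /and3P[lt_w' /eqP rw' /eqP cw']|no_w'] /=.
    by split=> //; rewrite inE lt_w' cw' lt_c.
  have [i lt_i [ri ci]] := filling_row fill (lt_M _ lt_w) (leq_trans lt_c le_C).
  have := no_w' (Ordinal (ltn_trans lt_i (ltn_ord w))).
  by rewrite /cell /= (ltn_trans lt_i lt_w) ri rw ci !eqxx.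
have long_r (u v : 'I_N) : r u = r v -> long u = long v by rewrite /long => ->.
have f_inj : {in A &, injective f}.
  move=> u v uA vA eq_f; have [_ ru +] := fP _ uA; have [_ rv +] := fP _ vA.
  have ruv : r u = r v by rewrite -ru -rv eq_f.
  rewrite (long_r _ _ ruv) eq_f; case: ifP => _ => [-> eq_c|-> //].
  move: uA vA; rewrite !inE => /andP[lt_u _] /andP[lt_v _].
  by apply: s_inj.
have sAB : f @: A \subset B.
  by apply/subsetP=> _ /imsetP[u uA ->]; have [] := fP _ uA.
have cardAB : #|A| = #|B|.
  rewrite -(card_imset (mem A) (@perm_inj _ s)); apply: eq_card => u.
  apply/imsetP/idP => [[v + ->]|].
    by rewrite !inE (initial_sym_lt _ sG).
  rewrite !inE => /andP[lt_u lt_c]; exists (s^-1%g u); last by rewrite permKV.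
  by rewrite !inE -(initial_sym_lt _ sG) permKV lt_u.
have : u0 \in B by rewrite !inE lt_u0 short_lt.
have /eqP<- : f @: A == B by rewrite eqEcard sAB (card_in_imset f_inj) cardAB leqnn.
case/imsetP=> u uA def_u0; have [_ + +] := fP _ uA; rewrite -def_u0 => ru.
rewrite -(long_r _ _ ru) (negbTE short_u0) => eq_u.
by move: uA; rewrite -eq_u !inE ltnn andbF.
Qed.

(** When no two boxes of a row go to the same column, p moves each box u inside
    its row to the column of s u, and p^-1 s preserves columns. *)
Lemma row_col_factor j s : (j <= M)%N -> s \in initial_sym N j ->
  (exists p q, [/\ p \in label_stab N r j, q \in label_stab N c j & s = p * q]%g)
  \/ (exists u v : 'I_N,
       [/\ (u < j)%N, (v < j)%N, u != v, r u = r v & c (s u) = c (s v)]).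
Proof.
move=> le_jM sG.
pose clash (uv : 'I_N * 'I_N) := [&& (uv.1 < j)%N, (uv.2 < j)%N, uv.1 != uv.2,
   r uv.1 == r uv.2 & c (s uv.1) == c (s uv.2)].
case: (pickP clash) => [[u v] /and5P[/= lt_u lt_v uv /eqP ruv /eqP cuv]|no_clash].
  by right; exists u, v.
left; have s_inj (u v : 'I_N) : (u < j)%N -> (v < j)%N -> r u = r v ->
    c (s u) = c (s v) -> u = v.
  move=> lt_u lt_v ruv cuv; have := no_clash (u, v).
  by rewrite /clash /= lt_u lt_v ruv cuv !eqxx !andbT; move/negbFE/eqP.
pose cell (u w : 'I_N) := [&& (w < j)%N, r w == r u & c w == c (s u)].
pose f (u : 'I_N) := if (u < j)%N then odflt u [pick w | cell u w] else u.
have fP (u : 'I_N) : (u < j)%N -> [/\ (f u < j)%N, r (f u) = r u & c (f u) = c (s u)].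
  move=> lt_u; rewrite /f lt_u.
  case: pickP => [w /and3P[lt_w /eqP-> /eqP->] //|no_w] /=.
  have [w lt_w [rw cw]] := dispersed_row le_jM sG s_inj lt_u.
  by have := no_w w; rewrite /cell lt_w rw cw !eqxx.
have fN (u : 'I_N) : (j <= u)%N -> f u = u by rewrite /f ltnNge => ->.
have f_inj : injective f.
  move=> u v; case: (ltnP u j) => [lt_u|le_u]; case: (ltnP v j) => [lt_v|le_v].
  - have [_ ru cu] := fP _ lt_u; have [_ rv cv] := fP _ lt_v.
    by move=> eq_f; apply: s_inj; rewrite // -?ru -?rv -?cu -?cv eq_f.
  - rewrite (fN v) // => eq_f; have [] := fP _ lt_u.
    by rewrite eq_f ltnNge le_v.
  - rewrite (fN u) // => eq_f; have [] := fP _ lt_v.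
    by rewrite -eq_f ltnNge le_u.
  by rewrite !fN.
pose p := perm f_inj; have pR : p \in label_stab N r j.
  apply/label_stabP; split=> [|u]; first by apply/initial_symP=> u le_u; rewrite permE fN.
  by rewrite permE; case: (ltnP u j) => [/fP[]|/fN->].
exists p, (p^-1 * s)%g; rewrite mulKVg; split=> //; apply/label_stabP; split=> [|u].
  by rewrite groupM // groupV (subsetP (label_stab_sub _ _ _) _ pR).
rewrite permM -{2}[u](permKV p); move: (p^-1%g u) => v; rewrite permE.
case: (ltnP v j) => [/fP[]//|le_v]; rewrite fN //.
by move/initial_symP: sG => ->.
Qed.

(** If s is not a product of a row and a column permutation, a transposition
    of a row becomes a transposition of a column when moved through s, so that
    x s y is its own opposite. *)
Lemma row_col_sum_delta j s : (j <= M)%N -> s \in initial_sym N j ->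
  exists k : algC, row_sum j * gdelta s * col_sum j = k *: (row_sum j * col_sum j).
Proof.
move=> le_jM sG; have [[p [q [pR qC ->]]]|] := row_col_factor le_jM sG.
  exists ((-1) ^+ q); rewrite gdeltaM !mulrA label_sum_mulr // scale1r.
  by rewrite -mulrA label_sum_mull // galg_scaler.
case=> u [v [lt_u lt_v uv ruv cuv]]; exists 0; rewrite scale0r.
set a := _ * _ * _; suffices: a = - a.
  move/eqP; rewrite -addr_eq0 -mulr2n -scaler_nat scaler_eq0 pnatr_eq0 /=.
  by move/eqP.
have tR : tperm u v \in label_stab N r j by apply: tperm_label_stab.
have tC : tperm (s u) (s v) \in label_stab N c j.
  by apply: tperm_label_stab; rewrite ?(initial_sym_lt _ sG).
rewrite {1}/a; have <- : row_sum j * gdelta (tperm u v) = row_sum j.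
  by rewrite label_sum_mulr // scale1r.
rewrite -[_ * gdelta s]mulrA -gdeltaM.
have -> : (tperm u v * s = s * tperm (s u) (s v))%g.
  by rewrite -tpermJ -conjgC.
rewrite gdeltaM mulrA -[_ * _ * col_sum j]mulrA label_sum_mull // odd_tperm.
by rewrite (inj_eq perm_inj) uv expr1 galg_scaler scaleN1r.
Qed.

Lemma row_col_stab1 j s : (j <= M)%N ->
  s \in label_stab N r j -> s \in label_stab N c j -> s = 1%g.
Proof.
move=> le_jM /label_stabP[sG sr] /label_stabP[_ sc]; apply/permP=> u.
rewrite perm1; case: (ltnP u j) => [lt_u|]; last exact/initial_symP.
apply/val_inj/(filling_inj fill); rewrite ?sr ?sc //.
  by apply: leq_trans le_jM; rewrite (initial_sym_lt _ sG).
exact: leq_trans le_jM.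
Qed.

Lemma gcoef1_row_col j : (j <= M)%N -> gcoef 1%g (row_sum j * col_sum j) = 1.
Proof.
move=> le_jM; rewrite {1}/label_sum mulr_suml linear_sum (bigD1 1%g) //=.
rewrite [X in _ + X]big1 ?addr0 => [|p /andP[pR p1]].
  rewrite scale1r gdelta1 mul1r /label_sum linear_sum (bigD1 1%g) //= big1 ?addr0.
    by rewrite linearZ /= gcoef_delta eqxx odd_perm1 mulr1.
  by move=> q /andP[_ /negbTE q1]; rewrite linearZ /= gcoef_delta q1 mulr0.
rewrite /label_sum mulr_sumr linear_sum big1 // => q qC.
rewrite galg_scaler galg_scalel !linearZ /= -gdeltaM gcoef_delta.
case: eqP => [/eqP|]; last by rewrite !mulr0.
rewrite -eq_invg_mul => /eqP eq_q; case/eqP: p1; apply: (row_col_stab1 le_jM) => //.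
by rewrite -groupV eq_q.
Qed.

(** The Young symmetrizer is primitive: x a y is always a multiple of x y, and
    the multiple is read off at the identity, where x y has coefficient 1. *)
Lemma row_col_sum_primitive j a : (j <= M)%N -> gspan (initial_sym N j) a ->
  row_sum j * a * col_sum j
    = gcoef 1%g (row_sum j * a * col_sum j) *: (row_sum j * col_sum j).
Proof.
move=> le_jM; elim=> [|k s {}a sG _ IH]; first by rewrite mulr0 mul0r linear0 scale0r.
rewrite mulrDr mulrDl {1}IH linearD scalerDl; congr (_ + _).
rewrite galg_scaler galg_scalel linearZ /= -scalerA; congr (_ *: _).
have [x ->] := row_col_sum_delta le_jM sG.
by rewrite linearZ /= gcoef1_row_col // mulr1.
Qed.

End VonNeumann.

(** * Moments of Jucys-Murphy elements against a Young symmetrizer *)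

Lemma standard_filling_tr r c M : standard_filling r c M -> standard_filling c r M.
Proof.
by case=> inj row col; split=> // i j lt_i lt_j eqc eqr; apply: inj.
Qed.

Lemma card_row_before (r c : nat -> nat) M N (j : 'I_N) :
    standard_filling r c M -> (j < M)%N ->
  #|[pred i : 'I_N | (i < j)%N && (r i == r j)]| = c j.
Proof.
move=> fill lt_jM; set A := [pred i : 'I_N | _].
have AP (i : 'I_N) : i \in A -> [/\ (i < j)%N, (i < M)%N & r i = r j].
  by case/andP=> lt_i /eqP ri; rewrite (ltn_trans lt_i lt_jM).
have eqA : perm_eq [seq c (i : 'I_N) | i in A] (iota 0 (c j)).
  apply: uniq_perm; rewrite ?iota_uniq //.
    rewrite map_inj_in_uniq ?enum_uniq // => i i'; rewrite !mem_enum => /AP[_ lt_i ri].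
    by case/AP=> _ lt_i' ri' ci; apply/val_inj/(filling_inj fill); rewrite ?ri.
  move=> k; rewrite mem_iota add0n leq0n /=.
  apply/imageP/idP => [[i /AP[lt_i lt_iM ri] ->]|].
    rewrite ltnNge; apply/negP=> le_c; have [eq_c|neq_c] := eqVneq (c i) (c j).
      by move: lt_i; rewrite (filling_inj fill lt_iM lt_jM ri eq_c) ltnn.
    have lt_c : (c j < c i)%N by rewrite ltn_neqAle eq_sym neq_c.
    have [i' lt_i' [ri' ci']] := filling_row fill lt_iM lt_c.
    have lt_i'j := ltn_trans lt_i' lt_i.
    have := filling_inj fill (ltn_trans lt_i'j lt_jM) lt_jM _ ci'.
    by rewrite ri' ri => /(_ erefl) eq_i'; rewrite eq_i' ltnn in lt_i'j.
  move=> lt_k; have [i lt_i [ri ci]] := filling_row fill lt_jM lt_k.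
  exists (Ordinal (ltn_trans lt_i (ltn_ord j))); last by rewrite /= ci.
  by rewrite /A inE /= lt_i ri eqxx.
by rewrite -(size_iota 0 (c j)) -(perm_size eqA) size_image.
Qed.

Section JucysMurphyElements.
Variable N : nat.
Local Notation galg := 'M[algC]_(gcard [set: 'S_N]).
Implicit Types (j : 'I_N) (s : 'S_N).

Definition jucys j : galg := \sum_(i : 'I_N | (i < j)%N) gdelta (tperm i j).

Lemma jucys_span j k : (j < k)%N -> gspan (initial_sym N k) (jucys j).
Proof.
move=> lt_jk; apply: gspan_sum => i lt_ij; apply/gspan_delta/tperm_initial_sym => //.
exact: ltn_trans lt_jk.
Qed.

Lemma jucys_comm_delta j s :
  s \in initial_sym N j -> GRing.comm (jucys j) (gdelta s).
Proof.
move=> sG; rewrite /GRing.comm mulr_suml mulr_sumr.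
rewrite [RHS](reindex_inj (@perm_inj _ s)); apply: eq_big => [i|i _].
  by rewrite /= (initial_sym_lt _ sG).
rewrite -!gdeltaM conjgC tpermJ; congr (gdelta (s * tperm _ _)).
by move/initial_symP: sG; apply.
Qed.

Lemma jucys_comm j a : gspan (initial_sym N j) a -> GRing.comm (jucys j) a.
Proof. by move=> Sa; apply: gspan_comm Sa _ => s; apply: jucys_comm_delta. Qed.

(** The class sum of transpositions enters twice, plus the identity once for
    each moved point; this makes its centrality a plain reindexing. *)
Definition transp_sum (k : nat) : galg :=
  \sum_(u : 'I_N | (u < k)%N) \sum_(v : 'I_N | (v < k)%N) gdelta (tperm u v).

Lemma transp_sum_comm k a : gspan (initial_sym N k) a -> GRing.comm (transp_sum k) a.
Proof.
move=> Sa; apply: gspan_comm Sa _ => s sG; rewrite /GRing.comm mulr_suml mulr_sumr.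
rewrite [RHS](reindex_inj (@perm_inj _ s)); apply: eq_big => [u|u _].
  by rewrite /= (initial_sym_lt _ sG).
rewrite mulr_suml mulr_sumr [RHS](reindex_inj (@perm_inj _ s)).
apply: eq_big => [v|v _]; first by rewrite /= (initial_sym_lt _ sG).
by rewrite -!gdeltaM conjgC tpermJ.
Qed.

Lemma transp_sumS j : transp_sum j.+1 = transp_sum j + (jucys j *+ 2 + 1).
Proof.
have ltS (u : 'I_N) : (u < j.+1)%N && (u != j) = (u < j)%N.
  by rewrite ltnS [RHS]ltn_neqAle andbC.
rewrite /transp_sum (bigD1 j) //= (eq_bigl _ _ ltS) (bigD1 j) //= (eq_bigl _ _ ltS).
rewrite tperm1 gdelta1; under [X in _ + X = _]eq_bigr => u lt_u.
  by rewrite (bigD1 j) //= (eq_bigl _ _ ltS); over.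
rewrite big_split /= -/(jucys j) [RHS]addrC [in RHS]mulr2n addrA; congr (_ + _).
rewrite [RHS]addrC addrA; congr (_ + _ + _).
by apply: eq_bigr => u _; rewrite tpermC.
Qed.

Lemma gcoef1_outside k (a b : galg) s :
    gspan (initial_sym N k) a -> gspan (initial_sym N k) b ->
  s \notin initial_sym N k -> gcoef 1%g (a * gdelta s * b) = 0.
Proof.
move=> Sa Sb sN; elim: Sa => [|x p {}a pG _ IH]; first by rewrite !mul0r linear0.
rewrite !mulrDl linearD /= IH addr0 !galg_scalel linearZ /=.
suffices ->: gcoef 1%g (gdelta p * gdelta s * b) = 0 by rewrite mulr0.
elim: Sb => [|y q {}b qG _ {}IH]; first by rewrite mulr0 linear0.
rewrite mulrDr linearD /= IH addr0 galg_scaler linearZ /= -!gdeltaM gcoef_delta.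
case: eqP => [eq1|]; last by rewrite mulr0.
case/negP: sN; rewrite -(groupMl _ pG) -(groupMr _ qG) eq1; exact: group1.
Qed.

End JucysMurphyElements.

Section Moments.
Variables (N M : nat) (r c : nat -> nat).
Hypothesis fill : standard_filling r c M.
Local Notation galg := 'M[algC]_(gcard [set: 'S_N]).
Implicit Types (j : 'I_N) (s : 'S_N).
Local Notation row_sum j := (label_sum N r j false).
Local Notation col_sum j := (label_sum N c j true).
Local Notation content j := ((c j)%:R - (r j)%:R : algC).

(** On the Specht module of the first j boxes, this is the normalized character
    of the part of jucys j ^+ k supported on the permutations of j points. *)
Definition jucys_moment j k : algC :=
  gcoef 1%g (row_sum j * jucys j ^+ k * col_sum j).

Let step_neq j (u v : 'I_N) : (j < M)%N -> (u < j)%N -> (v < j)%N ->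
  r u = r j -> c v = c j -> u != v.
Proof.
move=> lt_jM lt_u lt_v ru cv; apply/eqP=> eq_uv; rewrite -eq_uv in cv.
have eq_uj := filling_inj fill (ltn_trans lt_u lt_jM) lt_jM ru cv.
by rewrite eq_uj ltnn in lt_u.
Qed.

Let moves j s : s j != j -> s \notin initial_sym N j.
Proof. by apply: contra => /initial_symP->. Qed.

(** Expand the symmetrizers over cosets. Only products of transpositions that fix
    j contribute: the square of (i j) for i in the row of j, the same for i in the
    column of j with a sign, and no product of three transpositions, since a box
    is not at once in the row and in the column of j. *)
Lemma gcoef1_row_jucys_col j : (j < M)%N ->
  gcoef 1%g (row_sum j.+1 * jucys j * col_sum j.+1) = content j.
Proof.
move=> lt_jM; rewrite (label_sumSr r) (label_sumSl c).
have := gcoef1_row_col N fill (ltnW lt_jM).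
have := label_sum_span N c j true; have := label_sum_span N r j false.
move: (row_sum j) (col_sum j) => x y Sx Sy xy1.
set u := label_step _ _ _; set v := label_step _ _ _.
have nj (i : 'I_N) : (i < j)%N -> i != j by rewrite -val_eqE /= => /ltn_eqF->.
have -> : x * (1 + u) * jucys j * ((1 + v) * y)
    = x * jucys j * y + x * (u * jucys j) * y + x * (jucys j * v) * y
      + x * (u * jucys j * v) * y.
  rewrite [x * _]mulrDr mulr1 ![(x + _) * _]mulrDl [(1 + _) * _]mulrDl mul1r.
  by rewrite mulrDr !mulrDl !mulrA !addrA.
have single_sum (l : nat -> nat) (w : 'I_N -> 'I_N -> 'S_N) (e : algC) :
    (forall i i' : 'I_N, (i < j)%N -> (i' < j)%N -> i != i' -> w i i' j != j) ->
    (forall i, w i i = 1%g) ->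
  \sum_(i : 'I_N | (i < j)%N && (l i == l j)) \sum_(i' : 'I_N | (i' < j)%N)
     e * gcoef 1%g (x * gdelta (w i i') * y)
   = e *+ #|[pred i : 'I_N | (i < j)%N && (l i == l j)]|.
  move=> wj w1; rewrite -sumr_const; apply: eq_bigr => i /andP[lt_i _].
  rewrite (bigD1 i) //= w1 gdelta1 mulr1 xy1 mulr1 big1 ?addr0 // => i' /andP[lt_i' ne_i].
  by rewrite (gcoef1_outside Sx Sy) ?mulr0 // moves // wj // eq_sym.
rewrite !linearD /=.
have -> : gcoef 1%g (x * jucys j * y) = 0.
  rewrite mulr_sumr mulr_suml linear_sum /= big1 // => i lt_i.
  by rewrite (gcoef1_outside Sx Sy) // moves // tpermR nj.
have -> : gcoef 1%g (x * (u * jucys j) * y) = (c j)%:R.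
  rewrite -(card_row_before fill lt_jM) -(single_sum r (fun i i' => tperm i j * tperm i' j)%g).
  - rewrite /u /label_step !mulr_suml mulr_sumr mulr_suml linear_sum /=.
    apply: eq_bigr => i _; rewrite mulr_sumr mulr_sumr mulr_suml linear_sum /=.
    apply: eq_bigr => i' _; rewrite galg_scalel galg_scaler galg_scalel linearZ /=.
    by rewrite gdeltaM.
  - move=> i i' lt_i lt_i' ne_i; rewrite permM tpermR tpermD ?nj // 1?eq_sym //.
    by rewrite nj.
  by move=> i; rewrite tperm2.
have -> : gcoef 1%g (x * (jucys j * v) * y) = - (r j)%:R.
  rewrite -mulNrn -(card_row_before (standard_filling_tr fill) lt_jM).
  rewrite -(single_sum c (fun i i' => tperm i' j * tperm i j)%g).
  - rewrite /v /label_step !mulr_sumr mulr_suml linear_sum /=.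
    apply: eq_bigr => i _; rewrite galg_scaler galg_scaler galg_scalel linearZ /=.
    rewrite expr1 -mulr_sumr; congr (_ * _).
    rewrite mulr_suml mulr_sumr mulr_suml linear_sum /=.
    by apply: eq_bigr => i' _; rewrite gdeltaM.
  - move=> i i' lt_i lt_i' ne_i; rewrite permM tpermR tpermD ?nj //.
    by rewrite eq_sym nj.
  by move=> i; rewrite tperm2.
rewrite add0r [X in _ + X](_ : _ = 0) ?addr0 //.
rewrite /u /v /label_step !mulr_suml mulr_sumr mulr_suml linear_sum /= big1 // => i.
case/andP=> lt_i /eqP ri; rewrite [_ * jucys j]mulr_sumr mulr_suml mulr_sumr mulr_suml.
rewrite linear_sum /= big1 // => i' lt_i'.
rewrite mulr_sumr mulr_sumr mulr_suml linear_sum /= big1 // => i'' /andP[lt_i'' /eqP ci].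
rewrite !(galg_scalel, galg_scaler) !linearZ /= -!gdeltaM.
rewrite (gcoef1_outside Sx Sy) ?mulr0 // moves // !permM tpermR.
have ne_i := step_neq lt_jM lt_i lt_i'' ri ci.
have [<-|ne_i'] := eqVneq i i'; first by rewrite tpermL tpermR nj.
by rewrite !tpermD // ?nj // 1?eq_sym ?nj // eq_sym.
Qed.

Lemma row_jucys_col j : (j < M)%N ->
  row_sum j.+1 * jucys j * col_sum j.+1 = content j *: (row_sum j.+1 * col_sum j.+1).
Proof.
move=> lt_jM; rewrite (row_col_sum_primitive fill lt_jM) ?gcoef1_row_jucys_col //.
exact: jucys_span.
Qed.

Fixpoint transp_eigen k : algC :=
  if k is k'.+1 then transp_eigen k' + (content k' *+ 2 + 1) else 0.

(** Going from j to j + 1 boxes multiplies the row symmetrizer on the left and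
    the column antisymmetrizer on the right. *)
Lemma row_col_sum_step j a (z : algC) :
    row_sum j * a * col_sum j = z *: (row_sum j * col_sum j) ->
  row_sum j.+1 * a * col_sum j.+1 = z *: (row_sum j.+1 * col_sum j.+1).
Proof.
rewrite (label_sumSl r) (label_sumSr c).
move: (row_sum j) (col_sum j) => x y eq_z.
have -> : (1 + label_step r j false) * x * a * (y * (1 + label_step c j true))
    = (1 + label_step r j false) * (x * a * y) * (1 + label_step c j true).
  by rewrite !mulrA.
by rewrite eq_z galg_scaler galg_scalel !mulrA.
Qed.

(** Induction on k: the content of box k is the contribution of jucys k. *)
Lemma transp_sum_row_col k : (k <= M)%N -> (k <= N)%N ->
  row_sum k * transp_sum N k * col_sum k = transp_eigen k *: (row_sum k * col_sum k).
Proof.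
elim: k => [|k IH] lt_kM lt_kN.
  by rewrite scale0r /transp_sum big1 ?mulr0 ?mul0r.
pose j := Ordinal lt_kN; have := IH (ltnW lt_kM) (ltnW lt_kN).
rewrite -[k]/(nat_of_ord j) => {}IH; rewrite transp_sumS mulrDr mulrDl /= scalerDl.
congr (_ + _); first exact: (row_col_sum_step (j := j)).
rewrite mulr2n !mulrDr !mulrDl mulr1 (row_jucys_col (j := j)) // -[k]/(nat_of_ord j).
by rewrite mulr2n !scalerDl scale1r.
Qed.

(** Here jucys j is half of transp_sum j.+1 - transp_sum j - 1: the first sum is
    central among the permutations of j + 1 boxes, and the second one acts by a
    scalar between the symmetrizers of the first j boxes. *)
Lemma row_jucysX_col j k : (j < M)%N ->
  row_sum j.+1 * jucys j ^+ k * col_sum j.+1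
    = content j ^+ k *: (row_sum j.+1 * col_sum j.+1).
Proof.
move=> lt_jM; elim: k => [|k IH]; first by rewrite !expr0 scale1r mulr1.
have Sx : gspan (initial_sym N j.+1) (row_sum j.+1) by apply: label_sum_span.
have two_inj (a b : galg) : a *+ 2 = b *+ 2 -> a = b.
  by rewrite -!scaler_nat => /(scalerI (_ : 2%:R != 0)); apply; rewrite pnatr_eq0.
apply: two_inj; rewrite exprS -mulrnAl -mulrnAr -mulrnAl.
have -> : jucys j *+ 2 = transp_sum N j.+1 - transp_sum N j - 1.
  by rewrite transp_sumS [_ + (_ + _)]addrC !addrK.
rewrite !mulrBl !mulrBr !mulrBl mul1r IH.
have -> : row_sum j.+1 * (transp_sum N j.+1 * jucys j ^+ k) * col_sum j.+1
    = (content j ^+ k * transp_eigen j.+1) *: (row_sum j.+1 * col_sum j.+1).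
  rewrite [_ * (_ * _)]mulrA -(transp_sum_comm Sx) -2!mulrA.
  rewrite [row_sum _ * (_ * _)]mulrA IH galg_scaler [transp_sum _ _ * _]mulrA.
  by rewrite (transp_sum_comm Sx) transp_sum_row_col // scalerA.
have -> : row_sum j.+1 * (transp_sum N j * jucys j ^+ k) * col_sum j.+1
    = (content j ^+ k * transp_eigen j) *: (row_sum j.+1 * col_sum j.+1).
  rewrite [content j ^+ k * _]mulrC -scalerA -IH.
  rewrite (label_sumSl r) (label_sumSr c).
  have Sy : gspan (initial_sym N j) (col_sum j) by apply: label_sum_span.
  have cby : jucys j ^+ k * col_sum j = col_sum j * jucys j ^+ k.
    exact/esym/commrX/commr_sym/jucys_comm.
  have := transp_sum_row_col (ltnW lt_jM) (ltnW (ltn_ord j)).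
  move: (row_sum j) (col_sum j) cby => x y cby eq_z.
  set u := 1 + _; set v := 1 + _; set b := jucys j ^+ k in cby *.
  transitivity (u * (x * transp_sum N j * y) * b * v).
    by rewrite -!mulrA [b * (_ * _)]mulrA cby !mulrA.
  rewrite eq_z !(galg_scaler, galg_scalel); congr (_ *: _).
  by rewrite -!mulrA [y * (_ * _)]mulrA -cby !mulrA.
rewrite -!scalerBl scalerMnl exprS; congr (_ *: _) => /=.
by ring.
Qed.

(** The Hecke relation of consecutive Jucys-Murphy elements. *)
Lemma jucys_hecke j j' : j' = j.+1 :> nat ->
  jucys j' * gdelta (tperm j j') = gdelta (tperm j j') * jucys j + 1.
Proof.
move=> def_j'; rewrite /jucys (bigD1 j) /=; last by rewrite def_j'.
rewrite mulrDl -gdeltaM tperm2 gdelta1 addrC; congr (_ + _).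
rewrite mulr_suml mulr_sumr; apply: eq_big => [i|i /andP[lt_i ne_i]].
  by rewrite def_j' ltnS [RHS]ltn_neqAle andbC.
rewrite -!gdeltaM conjgC tpermJ tpermR tpermD // 1?eq_sym //.
by rewrite -val_eqE /= ltn_eqF.
Qed.

(** Conjugation by (j j+1) fixes the permutations of the first j points and sends
    the other permutations of the first j + 1 points to permutations that move
    j + 1, which do not contribute to the coefficient at the identity. *)
Lemma gcoef1_conj_tperm j j' a (x y x0 y0 : galg) : j' = j.+1 :> nat ->
    gspan (initial_sym N j.+1) x -> gspan (initial_sym N j.+1) y ->
    gspan (initial_sym N j) x0 -> gspan (initial_sym N j) y0 ->
    (forall s, s \in initial_sym N j ->
       gcoef 1%g (x * gdelta s * y) = gcoef 1%g (x0 * gdelta s * y0)) ->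
    gspan (initial_sym N j.+1) a ->
  gcoef 1%g (x * (gdelta (tperm j j') * a * gdelta (tperm j j')) * y)
    = gcoef 1%g (x0 * a * y0).
Proof.
move=> def_j' Sx Sy Sx0 Sy0 eq_xy; elim=> [|k s {}a sG _ IH].
  by rewrite !(mulr0, mul0r) !linear0.
rewrite !(mulrDr, mulrDl) !linearD /= IH; congr (_ + _).
rewrite !(galg_scaler, galg_scalel) !linearZ /=; congr (_ * _).
rewrite -!gdeltaM; have /initial_symP sP := sG.
have sj' : s j' = j' by apply: sP; rewrite def_j'.
have [eq_sj|ne_sj] := eqVneq (s j) j.
  rewrite [(_ * s)%g]conjgC tpermJ eq_sj sj' -mulgA tperm2 mulg1; apply: eq_xy.
  apply/initial_symP=> i; rewrite leq_eqVlt => /predU1P[eq_ji|/sP//].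
  by rewrite -(val_inj eq_ji).
rewrite (gcoef1_outside Sx0 Sy0) ?(gcoef1_outside Sx Sy) //.
  apply: contra ne_sj => /initial_symP/(_ j'); rewrite def_j' => /(_ (leqnn _)).
  by rewrite !permM tpermR => /(congr1 (tperm j j')); rewrite tpermK tpermR => ->.
by apply: contra ne_sj => /initial_symP->.
Qed.

(** With s exchanging j and j' = j + 1, expand jucys j' ^+ k as the product
    of jucys j' ^+ k * s and s by means of the Hecke relation, and replace jucys j
    by the content of the box j wherever it stands between the symmetrizers. The
    first term, s * jucys j ^+ k * s, gives the moment for j boxes; f and e collect
    what the first and the second use of the Hecke relation leave behind. *)
Lemma jucys_moment_rec j j' : j' = j.+1 :> nat -> (j < M)%N ->
  exists e f : nat -> algC, [/\ e 0%N = 0, f 0%N = 0,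
    forall k, e k.+1 = jucys_moment j' k + content j * e k,
    forall k, f k.+1 = e k + content j * f k
  & forall k, jucys_moment j' k = jucys_moment j k + f k].
Proof.
move=> def_j' lt_jM; rewrite /jucys_moment def_j'.
have Sx : gspan (initial_sym N j.+1) (row_sum j.+1) by apply: label_sum_span.
have Sy : gspan (initial_sym N j.+1) (col_sum j.+1) by apply: label_sum_span.
pose s := gdelta (tperm j j'); pose b := jucys j'; pose a := jucys j.
have ss : s * s = 1 by rewrite -gdeltaM tperm2 gdelta1.
have Sa : gspan (initial_sym N j.+1) a by apply: jucys_span.
have bS z : gspan (initial_sym N j.+1) z -> forall k, z * b ^+ k = b ^+ k * z.
  by move=> Sz k; apply: commrX; apply/commr_sym/jucys_comm; rewrite def_j'.
have xay k := row_jucysX_col k lt_jM.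
have trs k : gcoef 1%g (row_sum j.+1 * (s * a ^+ k * s) * col_sum j.+1)
           = gcoef 1%g (row_sum j * a ^+ k * col_sum j).
  apply: gcoef1_conj_tperm => //; try exact: label_sum_span; last exact: gspanX.
  move=> t tG; have [z eq_z] := row_col_sum_delta fill (ltnW lt_jM) tG.
  rewrite (row_col_sum_step eq_z) eq_z !linearZ /=.
  by rewrite (gcoef1_row_col N fill) // (gcoef1_row_col N fill) // ltnW.
have out (u v : galg) : gspan (initial_sym N j.+1) u -> gspan (initial_sym N j.+1) v ->
    gcoef 1%g (u * s * v) = 0.
  move=> Su Sv; apply: (gcoef1_outside Su Sv); apply/negP=> /initial_symP/(_ j').
  rewrite def_j' => /(_ (leqnn _)); rewrite tpermR => /(congr1 val) /= eq_j.
  by move: def_j'; rewrite -eq_j => /n_Sn.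
(* D k is the sum of b ^+ i * a ^+ l over i + l = k - 1. *)
pose fix D k : galg := if k is k'.+1 then b ^+ k' + D k' * a else 0.
have bD k : b ^+ k * s = s * a ^+ k + D k.
  elim: k => [|k IH] /=; first by rewrite !expr0 mul1r mulr1 addr0.
  rewrite exprSr -mulrA jucys_hecke // -/s -/a mulrDr mulr1 mulrA IH mulrDl.
  by rewrite -mulrA -exprSr -addrA [_ * a + _]addrC.
move: (row_sum j.+1) (col_sum j.+1) Sx Sy xay trs => x y Sx Sy xay trs.
(* E k is D k with a replaced by its value between x and y. *)
pose fix E k : galg := if k is k'.+1 then b ^+ k' + content j *: E k' else 0.
have Sxa l : gspan (initial_sym N j.+1) (x * a ^+ l) by apply: gspanM => //; apply: gspanX.
have aD k : a * D k = D k * a.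
  elim: k => [|k IH] /=; first by rewrite mulr0 mul0r.
  by rewrite mulrDr mulrDl mulrA IH (bS a).
have xDy k l : x * a ^+ l * D k * y = content j ^+ l *: (x * y * E k).
  elim: k l => [|k IH] l /=; first by rewrite !(mulr0, mul0r) scaler0.
  rewrite [x * y * _]mulrDr scalerDr mulrDr mulrDl; congr (_ + _).
    by rewrite -mulrA -(bS y) // mulrA xay galg_scalel.
  rewrite -aD mulrA -[x * _ * a]mulrA -exprSr IH galg_scaler scalerA.
  by rewrite exprSr.
pose e k := gcoef 1%g (x * y * E k).
pose f k := gcoef 1%g (x * D k * s * y).
have expand w k : w * D k.+1 * s * y
    = w * s * (a ^+ k * y) + w * D k * y + w * (a * D k) * s * y.
  rewrite [D _]/= mulrDr !mulrDl -[w * _ * s]mulrA bD mulrDr mulrDl aD !mulrA.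
  by [].
have Say k : gspan (initial_sym N j.+1) (a ^+ k * y) by apply: gspanM => //; apply: gspanX.
have xDsy k l : gcoef 1%g (x * a ^+ l * D k * s * y) = content j ^+ l * f k.
  rewrite /f; elim: k l => [|k IH] l; first by rewrite !(mulr0, mul0r) linear0 mulr0.
  rewrite !expand !linearD /= !(out _ (a ^+ k * y)) // !add0r.
  have -> : x * a ^+ l * (a * D k) = x * a ^+ l.+1 * D k by rewrite exprSr !mulrA.
  have -> : x * (a * D k) = x * a ^+ 1 * D k by rewrite expr1 mulrA.
  have := xDy k 0%N; rewrite !expr0 mulr1 scale1r => ->.
  by rewrite !IH xDy linearZ /= mulrDr exprSr expr1 !mulrA.
exists e, f; split.
- by rewrite /e /= mulr0 linear0.
- by rewrite /f /= mulr0 !mul0r linear0.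
- move=> k; rewrite /e /= mulrDr linearD galg_scaler linearZ /=; congr (_ + _).
  by rewrite -[x * _ * y]mulrA -(bS y) // mulrA.
- move=> k; rewrite {1}/f expand !linearD /= (out _ (a ^+ k * y)) // add0r.
  have := xDy k 0%N; rewrite !expr0 mulr1 scale1r => ->; congr (_ + _).
  by rewrite mulrA -[a]expr1 xDsy.
move=> k; have -> : jucys j' ^+ k = s * a ^+ k * s + D k * s.
  by rewrite -[LHS]mulr1 -ss mulrA bD mulrDl.
by rewrite mulrDr mulrDl linearD /= trs /f !mulrA.
Qed.

End Moments.
(** * Kerov's transition measure as a product over boxes *)

Section TruncatedSeries.
Variables (R : comNzRingType) (K : nat).
Implicit Types p q : {poly R}.

(** Moments of bounded order only involve generating series up to that order, so
    polynomials stand for power series. *)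
Definition eq_upto p q := forall i, (i < K)%N -> p`_i = q`_i.

Lemma eq_upto_sym p q : eq_upto p q -> eq_upto q p.
Proof. by move=> eq_pq i /eq_pq. Qed.

Lemma eq_upto_trans p q s : eq_upto p q -> eq_upto q s -> eq_upto p s.
Proof. by move=> eq_pq eq_qs i lt_i; rewrite eq_pq ?eq_qs. Qed.

Lemma eq_uptoD p p' q q' :
  eq_upto p p' -> eq_upto q q' -> eq_upto (p + q) (p' + q').
Proof. by move=> eq_p eq_q i lt_i; rewrite !coefD eq_p ?eq_q. Qed.

Lemma eq_uptoM p p' q q' :
  eq_upto p p' -> eq_upto q q' -> eq_upto (p * q) (p' * q').
Proof.
move=> eq_p eq_q i lt_i; rewrite !coefM; apply: eq_bigr => -[j /= lt_j] _.
by rewrite eq_p ?eq_q //; lia.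
Qed.

Lemma eq_upto_mull p q q' : p`_0 = 1 -> eq_upto (p * q) (p * q') -> eq_upto q q'.
Proof.
move=> p0 eq_pq i; have [n] := ubnP i; elim: n i => // n IH i lt_in lt_iK.
have := eq_pq i lt_iK; rewrite !coefM !big_ord_recl /= p0 !mul1r !subn0.
move=> eq_i; apply: (addIr (\sum_(j < i) p`_(bump 0 j) * q`_(i - bump 0 j))).
rewrite eq_i; congr (_ + _); apply: eq_bigr => -[j /= lt_j] _; rewrite /bump /=.
by rewrite (IH (i - (1 + j))%N) //; lia.
Qed.

End TruncatedSeries.

(** Generating series are written in w = 1/z, where z - x becomes 1 - x w. *)
Definition linfac (z : algC) : {poly algC} := 1 - z *: 'X.

Lemma linfac_coef0 z : (linfac z)`_0 = 1.
Proof. by rewrite coefB coefZ coefX coef1 mulr0 subr0. Qed.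

Lemma linfac_neq0 z : linfac z != 0.
Proof.
apply/eqP=> /(congr1 (fun p : {poly algC} => p`_0)).
by rewrite linfac_coef0 coef0 => /eqP; rewrite oner_eq0.
Qed.

Lemma coef_mul_linfac p z k :
  (p * linfac z)`_k = p`_k - z * (if k is k'.+1 then p`_k' else 0).
Proof.
by rewrite mulrBr mulr1 -scalerAr coefB coefZ coefMX; case: k.
Qed.

Lemma linfac_sub z d : linfac (z - d) = linfac z + d *: 'X.
Proof. by rewrite /linfac scalerBl opprB addrA addrAC. Qed.

Lemma linfac_add z d : linfac (z + d) = linfac z - d *: 'X.
Proof. by rewrite /linfac scalerDl opprD addrA. Qed.

Section MomentSeries.
Variables (N M K : nat) (r c : nat -> nat).
Hypothesis fill : standard_filling r c M.
Local Notation content j := ((c j)%:R - (r j)%:R : algC).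

Lemma label_stab0 l : label_stab N l 0 = 1%g.
Proof.
apply/setP=> s; rewrite !inE; apply/andP/eqP => [[/forallP s1 _]|->].
  by apply/permP=> i; rewrite perm1; apply/eqP/s1.
by split; apply/forallP=> i; rewrite perm1 eqxx.
Qed.

Lemma jucys_moment0 (j : 'I_N) k : j = 0%N :> nat ->
  jucys_moment r c j k = (k == 0%N)%:R.
Proof.
move=> j0; have sum1 l e : label_sum N l 0 e = 1.
  by rewrite /label_sum label_stab0 big_set1 odd_perm1 andbF scale1r gdelta1.
rewrite /jucys_moment j0 !sum1 mul1r mulr1 /jucys big1 => [|i]; last by rewrite j0.
rewrite expr0n; case: (k == 0%N); last by rewrite linear0.
by rewrite -gdelta1 gcoef_delta eqxx.
Qed.

Definition moment_series (j : 'I_N) : {poly algC} := \poly_(k < K) jucys_moment r c j k.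

(** The recursion for the moments says that adding a box of content z divides
    the generating series in w by 1 - w^2 / (1 - z w)^2. *)
Lemma moment_series_rec (j j' : 'I_N) : j' = j.+1 :> nat -> (j < M)%N ->
  eq_upto K
    (moment_series j' * (linfac (content j - 1) * linfac (content j + 1)))
    (moment_series j * linfac (content j) ^+ 2).
Proof.
move=> def_j' lt_jM; set z := content j.
have [e [f [e0 f0 eS fS gE]]] := jucys_moment_rec fill def_j' lt_jM.
pose E : {poly algC} := \poly_(k < K) e k; pose F : {poly algC} := \poly_(k < K) f k.
have EX : eq_upto K (E * linfac z) ('X * moment_series j').
  move=> [|k] lt_k; rewrite coef_mul_linfac coefXM /= !coef_poly lt_k;
    rewrite ?e0 ?mulr0 ?subr0 //.
  by rewrite (ltnW lt_k) eS addrK.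
have FX : eq_upto K (F * linfac z) ('X * E).
  move=> [|k] lt_k; rewrite coef_mul_linfac coefXM /= !coef_poly lt_k;
    rewrite ?f0 ?mulr0 ?subr0 //.
  by rewrite (ltnW lt_k) fS addrK.
have GF : eq_upto K (moment_series j') (moment_series j + F).
  by move=> k lt_k; rewrite coefD !coef_poly lt_k gE.
have F2 : eq_upto K (F * linfac z ^+ 2) ('X ^+ 2 * moment_series j').
  rewrite !expr2 mulrA -[X in eq_upto _ _ X]mulrA.
  apply: eq_upto_trans (eq_uptoM FX _) _ => //.
  by rewrite -mulrA; apply: eq_uptoM.
have -> : linfac (z - 1) * linfac (z + 1) = linfac z ^+ 2 - 'X ^+ 2.
  by rewrite linfac_sub linfac_add scale1r subr_sqr mulrC.
have G2 : eq_upto K (moment_series j' * linfac z ^+ 2)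
    (moment_series j * linfac z ^+ 2 + 'X ^+ 2 * moment_series j').
  apply: eq_upto_trans (eq_uptoM GF _) _ => //; rewrite mulrDl.
  by apply: eq_uptoD.
move=> k lt_k; rewrite mulrBr coefB G2 // coefD.
by rewrite [moment_series j' * _]mulrC addrK.
Qed.

Lemma moment_series_prod (j : 'I_N) : (j <= M)%N ->
  eq_upto K
    (moment_series j * \prod_(i < j) (linfac (content i - 1) * linfac (content i + 1)))
    (\prod_(i < j) linfac (content i) ^+ 2).
Proof.
case: j => j; elim: j => [|j IH] lt_jN /= le_jM.
  rewrite !big_ord0 mulr1 => k lt_k.
  by rewrite coef_poly lt_k jucys_moment0 // coef1.
have {}IH := IH (ltnW lt_jN) (ltnW le_jM); rewrite !big_ord_recr /=.
set A := \prod_(i < j) _ in IH *; set B := \prod_(i < j) _ in IH *.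
have rec := @moment_series_rec (Ordinal (ltnW lt_jN)) (Ordinal lt_jN) erefl le_jM.
rewrite [A * _]mulrC mulrA.
apply: eq_upto_trans (eq_uptoM rec _) _ => //; rewrite -/(content j) mulrAC.
exact: eq_uptoM.
Qed.

End MomentSeries.
Section DiagramFilling.
Variable nu : young.
Local Notation row i := (reshape_index nu i).
Local Notation col i := (reshape_offset nu i).

Lemma young_anti i j : (i <= j)%N -> (nth 0 nu j <= nth 0 nu i)%N.
Proof.
have /andP[/sorted_geqP dec _] := rowsP nu.
move/subnKC <-; elim: (j - i)%N => [|d IH]; first by rewrite addn0.
by rewrite addnS (leq_trans (dec _)).
Qed.

Lemma leq_sumn_take (s : seq nat) i j : (i <= j)%N -> (sumn (take i s) <= sumn (take j s))%N.
Proof.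
move=> le_ij; rewrite -(subnKC le_ij) takeD sumn_cat; exact: leq_addr.
Qed.

Lemma flatten_index_lt (sh : seq nat) i k i' k' : (i < i')%N -> (k < nth 0 sh i)%N ->
  (flatten_index sh i k < flatten_index sh i' k')%N.
Proof.
move=> lt_i lt_k; rewrite /flatten_index; apply: leq_trans (leq_addr _ _).
apply: leq_trans (leq_sumn_take _ lt_i); rewrite -[i.+1]addn1 takeD sumn_cat ltn_add2l.
case: (ltnP i (size sh)) => [lt_is|le_s]; last by rewrite nth_default in lt_k.
by rewrite (drop_nth 0%N lt_is) /= take0 addn0.
Qed.

Lemma young_filling :
  standard_filling (reshape_index nu) (reshape_offset nu) (boxes nu).
Proof.
split=> [i j _ _ eq_r eq_c|i k lt_i lt_k|i k lt_i lt_k].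
- by rewrite -(reshape_indexK nu i) eq_r eq_c reshape_indexK.
- have lt_k' := ltn_trans lt_k (reshape_offsetP lt_i).
  exists (flatten_index nu (row i) k); last by rewrite flatten_indexKl ?flatten_indexKr.
  by rewrite -{2}(reshape_indexK nu i) /flatten_index ltn_add2l.
have lt_c := leq_trans (reshape_offsetP lt_i) (young_anti (ltnW lt_k)).
exists (flatten_index nu k (col i)); last by rewrite flatten_indexKl ?flatten_indexKr.
by rewrite -{2}(reshape_indexK nu i) flatten_index_lt.
Qed.

End DiagramFilling.

Lemma big_reshape (R : comNzRingType) (F : nat -> nat -> R) (sh : seq nat) :
  \prod_(i < sumn sh) F (reshape_index sh i) (reshape_offset sh i)
    = \prod_(i < size sh) \prod_(k < nth 0%N sh i) F i k.
Proof.
elim: sh F => [|n sh IH] F; first by rewrite !big_ord0.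
rewrite big_ord_recl /= big_split_ord /= -(IH (fun i => F i.+1)); congr (_ * _).
  apply: eq_bigr => -[i /= lt_i] _.
  by rewrite /reshape_offset /reshape_index /= subn_eq0 lt_i subn0.
apply: eq_bigr => i _; rewrite /reshape_offset /reshape_index /=.
by rewrite -addnS addKn /= subnDl.
Qed.

Section TransitionSeries.
Variable nu : young.
Local Notation content i := ((reshape_offset nu i)%:R - (reshape_index nu i)%:R : algC).
Local Notation addfac := (\prod_(x <- addable_contents nu) linfac x%:~R).
Local Notation remfac := (\prod_(y <- removable_contents nu) linfac y%:~R).

Lemma row_telescope (i n : nat) :
  \prod_(k < n) (linfac (k%:R - i%:R - 1) * linfac (k%:R - i%:R + 1))
     * (linfac (- i%:R) * linfac (n%:R - i%:R - 1))
  = \prod_(k < n) linfac (k%:R - i%:R) ^+ 2 * (linfac (n%:R - i%:R) * linfac (- i%:R - 1)).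
Proof.
elim: n => [|n IH]; first by rewrite !big_ord0 !sub0r.
rewrite !big_ord_recr /= -natr1.
have -> : n%:R + 1 - i%:R - 1 = n%:R - i%:R :> algC by ring.
have -> : n%:R + 1 - i%:R = n%:R - i%:R + 1 :> algC by ring.
set A := \prod_(k < n) _ in IH *; set B := \prod_(k < n) _ in IH *.
transitivity ((A * (linfac (- i%:R) * linfac (n%:R - i%:R - 1)))
   * (linfac (n%:R - i%:R + 1) * linfac (n%:R - i%:R))); first by ring.
by rewrite IH; ring.
Qed.

(** The factors of consecutive boxes of a row telescope, leaving those at both
    ends of the row; the left ends telescope down the first column, and the
    right ends cancel between rows of equal length, which are the rows that
    have no corner. *)
Lemma transition_box_prod :
  remfac * \prod_(i < boxes nu) (linfac (content i - 1) * linfac (content i + 1))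
    = addfac * \prod_(i < boxes nu) linfac (content i) ^+ 2.
Proof.
have /andP[/sorted_geqP dec nu_pos] := rowsP nu.
have gt0 i : (i < size nu)%N -> (0 < nth 0 nu i)%N.
  by move=> lt_i; rewrite lt0n; apply: contraNneq nu_pos => <-; apply: mem_nth.
pose F (z : nat -> algC) := \prod_(i < size nu) linfac (z i).
pose len i : algC := (nth 0%N nu i)%:R.
have boxesE : \prod_(i < boxes nu) (linfac (content i - 1) * linfac (content i + 1))
      * (F (fun i => - i%:R) * F (fun i => len i - i%:R - 1))
    = \prod_(i < boxes nu) linfac (content i) ^+ 2
      * (F (fun i => len i - i%:R) * F (fun i => - i%:R - 1)).
  rewrite (big_reshape (fun i k => linfac (k%:R - i%:R - 1) * linfac (k%:R - i%:R + 1))).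
  rewrite (big_reshape (fun i k => linfac (k%:R - i%:R) ^+ 2)) /F -!big_split /=.
  by apply: eq_bigr => i _; apply: row_telescope.
have leftE : F (fun i => - i%:R - 1) = F (fun i => - i%:R) * linfac (- (size nu)%:R).
  have := erefl (\prod_(i < (size nu).+1) linfac (- i%:R)).
  rewrite {1}big_ord_recl big_ord_recr /= oppr0 {1}/linfac scale0r subr0 mul1r => <-.
  by apply: eq_bigr => i _; rewrite /bump add1n -natr1 opprD.
pose corner i := (nth 0 nu i.+1 < nth 0 nu i)%N.
pose rest : {poly algC} := \prod_(i < size nu | ~~ corner i) linfac (len i - i%:R - 1).
have remE : F (fun i => len i - i%:R - 1) = remfac * rest.
  rewrite /F (bigID (fun i : 'I_(size nu) => corner i)) /=; congr (_ * _).
  rewrite big_map removable_rowsE big_filter -[X in iota _ X]subn0 -/(index_iota 0 _).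
  rewrite big_mkord; apply: eq_bigr => i _; congr linfac.
  by rewrite /len intrB /= -!pmulrn -subn1 natrB ?gt0 // addrAC.
have addE : F (fun i => len i - i%:R) * linfac (- (size nu)%:R) = addfac * rest.
  have := erefl (\prod_(i < (size nu).+1) linfac (len i - i%:R)).
  rewrite {1}big_ord_recr /= {2}/len nth_default // sub0r => ->; rewrite big_ord_recl.
  rewrite big_map addable_rowsE big_cons big_map removable_rowsE big_filter -mulrA.
  rewrite intrB /= -!pmulrn; congr (_ * _); rewrite -[X in iota _ X]subn0 -/(index_iota 0 _).
  rewrite big_mkord (bigID (fun i : 'I_(size nu) => corner i)) /=; congr (_ * _).
    by apply: eq_bigr => i _; rewrite intrB.
  apply: eq_bigr => i; rewrite -leqNgt => le_i.
  have -> : len i = len i.+1.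
    by rewrite /len; congr (_%:R); apply/eqP; rewrite eqn_leq le_i; apply: dec.
  by congr linfac; rewrite /bump add1n -natr1 opprD addrA.
have nz : F (fun i => - i%:R) * rest != 0.
  by rewrite mulf_eq0 negb_or; apply/andP; split; apply/prodf_neq0 => i _; apply: linfac_neq0.
apply: (mulIf nz); rewrite leftE remE in boxesE.
set A := \prod_(i < boxes nu) _ in boxesE *; set B := \prod_(i < boxes nu) _ in boxesE *.
transitivity (A * (F (fun i => - i%:R) * (remfac * rest))); first by ring.
rewrite boxesE.
transitivity (B * F (fun i => - i%:R) * (F (fun i => len i - i%:R) * linfac (- (size nu)%:R))).
  by ring.
by rewrite addE; ring.
Qed.

End TransitionSeries.
Lemma eq_upto_sum (R : comNzRingType) K (I : eqType) (s : seq I) (F G : I -> {poly R}) :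
  (forall i, i \in s -> eq_upto K (F i) (G i)) ->
  eq_upto K (\sum_(i <- s) F i) (\sum_(i <- s) G i).
Proof.
move=> eqFG k lt_k; rewrite !coef_sum; apply: eq_big_seq => i /eqFG; exact.
Qed.

Lemma poly_eq0_eval (p : {poly algC}) : (forall w, p.[w] = 0) -> p = 0.
Proof.
move=> p0; apply/eqP/contraT=> nz_p.
have := @max_poly_roots _ p [seq i%:R | i <- iota 0 (size p)] nz_p.
rewrite size_map size_iota ltnn => -> //.
  by apply/allP=> w _; apply/eqP.
by rewrite map_inj_uniq ?iota_uniq // => i j /eqP; rewrite eqr_nat => /eqP.
Qed.

Section TransitionMoments.
Variables (nu : young) (m : atomic_measure).
Hypothesis mP : is_transition_measure nu m.
Local Notation X := (addable_contents nu).
Local Notation Y := (removable_contents nu).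

Lemma addable_contents_uniq : uniq X.
Proof.
have := removable_interlacing nu (size nu) (leqnn 0); rewrite -removable_rowsE.
move/interlacing_uniq; congr uniq; rewrite /addable_contents addable_rowsE /=.
by rewrite /unzip2 -!map_comp.
Qed.

Lemma size_addable_contents : size X = (size Y).+1.
Proof. by rewrite !size_map addable_rowsE /= size_map. Qed.

Lemma moment_addable k : moment m k = \sum_(x <- X) m x * x%:~R ^+ k.
Proof.
rewrite [RHS](bigID [in finsupp m]) /= [X in _ + X]big1_seq ?addr0; last first.
  by move=> x /andP[+ _]; rewrite mem_finsupp negbK => /eqP->; rewrite mul0r.
rewrite -[RHS]big_filter; apply: perm_big.
apply: uniq_perm; rewrite ?fset_uniq ?filter_uniq ?addable_contents_uniq // => x.
by rewrite mem_filter andb_idr // => /(transition_support mP).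
Qed.

Lemma horner_linfac z w : (linfac z).[w] = 1 - z * w.
Proof. by rewrite /linfac !hornerE. Qed.

Lemma prod_inv_linfac (s : seq int) (w : algC) : w != 0 ->
  \prod_(x <- s) (w^-1 - x%:~R) = w^-1 ^+ size s * (\prod_(x <- s) linfac x%:~R).[w].
Proof.
move=> nz; elim: s => [|x s IH]; first by rewrite !big_nil hornerC mulr1.
rewrite !big_cons hornerM horner_linfac IH exprS.
by field.
Qed.

(** The identity that defines the measure, at z = 1/w and cleared of
    denominators; it holds off finitely many w, hence identically. *)
Lemma transition_partial_fractions :
  \prod_(y <- Y) linfac y%:~R
    = \sum_(x <- X) m x *: \prod_(x' <- rem x X) linfac x'%:~R.
Proof.
set P := \prod_(x <- X) linfac x%:~R.
have PE x : x \in X -> P = linfac x%:~R * \prod_(x' <- rem x X) linfac x'%:~R.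
  by move=> Xx; rewrite /P (big_rem x Xx).
apply/eqP; rewrite -subr_eq0; set d := _ - _.
have nzP : P * 'X != 0.
  rewrite mulf_neq0 ?polyX_eq0 // prodf_seq_neq0; apply/allP=> x _.
  by rewrite linfac_neq0.
rewrite -(mulIr_eq0 _ (mulIf nzP)); apply/eqP/poly_eq0_eval => w.
rewrite !hornerM hornerX.
have [->|nz_w] := eqVneq w 0; first by rewrite !mulr0.
have [->|nz_P] := eqVneq P.[w] 0; first by rewrite mul0r mulr0.
have nz x : x \in X -> 1 - x%:~R * w != 0.
  move=> Xx; apply: contraNneq nz_P => w0.
  by rewrite (PE _ Xx) hornerM horner_linfac w0 mul0r.
have /(transition_fraction mP) : forall x, x \in X -> w^-1 != x%:~R.
  move=> x /nz; apply: contraNneq => <-.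
  by rewrite mulVf // subrr.
rewrite !prod_inv_linfac // size_addable_contents -/P => eq_frac.
rewrite /d hornerD hornerN horner_sum -[X in X - _](mulfVK nz_P).
have -> : (\prod_(y <- Y) linfac y%:~R).[w] / P.[w]
    = w^-1 * \sum_(x <- X) m x / (w^-1 - x%:~R).
  rewrite -eq_frac exprS; field; by rewrite nz_P nz_w expf_neq0 ?invr_neq0.
rewrite mulr_sumr mulr_suml -sumrB big1_seq ?mul0r // => x /andP[_ Xx].
rewrite hornerZ (PE _ Xx) hornerM horner_linfac.
have := nz _ Xx => nz_x; field.
by rewrite nz_w mulNr.
Qed.

Lemma transition_series K :
  eq_upto K ((\poly_(k < K) moment m k) * \prod_(x <- X) linfac x%:~R)
            (\prod_(y <- Y) linfac y%:~R).
Proof.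
pose geom (x : int) : {poly algC} := \poly_(k < K) x%:~R ^+ k.
have geomE x : eq_upto K (geom x * linfac x%:~R) 1.
  move=> [|k] lt_k; rewrite coef_mul_linfac !coef_poly lt_k.
    by rewrite mulr0 subr0 coef1.
  by rewrite (ltnW lt_k) exprS subrr coef1.
have -> : \poly_(k < K) moment m k = \sum_(x <- X) m x *: geom x.
  apply/polyP=> k; rewrite coef_poly coef_sum; case: ifP => lt_k.
    by rewrite moment_addable; apply: eq_bigr => x _; rewrite coefZ coef_poly lt_k.
  by rewrite big1 // => x _; rewrite coefZ coef_poly lt_k mulr0.
rewrite mulr_suml transition_partial_fractions; apply: eq_upto_sum => x Xx.
rewrite (big_rem x Xx) /= -scalerAl mulrA.
move=> k lt_k; rewrite !coefZ; congr (_ * _).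
by rewrite (eq_uptoM (geomE x) (fun _ _ => erefl) lt_k) mul1r.
Qed.

(** The generating series of both sides equal the same product over boxes. *)
Lemma jucys_moment_transition N (j : 'I_N) k : j = boxes nu :> nat ->
  jucys_moment (reshape_index nu) (reshape_offset nu) j k = moment m k.
Proof.
move=> def_j; pose K := k.+1.
have := @moment_series_prod N _ K _ _ (young_filling nu) j (eq_leq def_j).
rewrite def_j; set A := \prod_(i < _) _; set B := \prod_(i < _) _ => GA.
have box := transition_box_prod nu; rewrite -/A -/B in box.
have H := @transition_series K; set P := \prod_(x <- X) _ in box H.
have P0 : (A * P)`_0 = 1.
  rewrite coef0M /A /P !coef0_prod big1 => [|i _].
    by rewrite mul1r big1 // => x _; apply: linfac_coef0.
  by rewrite coef0M !linfac_coef0 mulr1.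
have main : eq_upto K (moment_series K (reshape_index nu) (reshape_offset nu) j)
   (\poly_(k < K) moment m k).
  apply: (eq_upto_mull P0); apply: (@eq_upto_trans _ _ _ (B * P)).
    by rewrite mulrC mulrA; apply: eq_uptoM.
  rewrite [B * P]mulrC -box.
  have -> (H' : {poly algC}) : A * P * H' = H' * P * A by ring.
  by apply: eq_uptoM => //; apply: eq_upto_sym.
by have := main k (leqnn _); rewrite !coef_poly ltnSn.
Qed.

End TransitionMoments.
(** * Characters of Specht modules *)

Section SpechtCharacter.
Variable nu : young.
Local Notation m := (boxes nu).
Local Notation row_sum := (label_sum m (reshape_index nu) m false).
Local Notation col_sum := (label_sum m (reshape_offset nu) m true).
Local Notation aG := (regular_repr algC [set: 'S_m]).

Lemma initial_symT (s : 'S_m) : s \in initial_sym m m.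
Proof. by apply/initial_symP=> i; rewrite leqNgt ltn_ord. Qed.

Lemma row_stabE : row_stab nu = label_stab m (reshape_index nu) m.
Proof. by apply/setP=> s; rewrite [RHS]inE initial_symT inE. Qed.

Lemma col_stabE : col_stab nu = label_stab m (reshape_offset nu) m.
Proof. by apply/setP=> s; rewrite [RHS]inE initial_symT inE. Qed.

Lemma young_symmetrizerE : young_symmetrizer nu = row_sum * col_sum.
Proof.
rewrite /label_sum /young_symmetrizer row_stabE col_stabE mulr_suml.
apply: eq_bigr => p _; rewrite mulr_sumr; apply: eq_bigr => q _.
by rewrite scale1r galg_scaler -gdeltaM.
Qed.

(** The function whose class average is the normalized Specht character. *)
Definition symmetrizer_coef (s : 'S_m) : algC :=
  gcoef 1%g (young_symmetrizer nu * gdelta s).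

Lemma symmetrizer_coef1 : symmetrizer_coef 1%g = 1.
Proof.
rewrite /symmetrizer_coef gdelta1 mulr1 young_symmetrizerE.
exact: (gcoef1_row_col _ (young_filling nu) (leqnn _)).
Qed.

Definition specht_dim := \rank (cyclic_mx aG (gring_row (young_symmetrizer nu))).

Lemma specht_dim_neq0 : specht_dim%:R != 0 :> algC.
Proof.
rewrite pnatr_eq0 mxrank_eq0; apply/eqP=> U0.
have := cyclic_mx_id aG (gring_row (young_symmetrizer nu)).
rewrite U0 submx0 => /eqP u0; have := symmetrizer_coef1.
rewrite /symmetrizer_coef gdelta1 mulr1 /gcoef u0 mxE => /eqP.
by rewrite eq_sym oner_eq0.
Qed.

Lemma gspan_setT (a : 'M[algC]_(gcard [set: 'S_m])) :
  (a \in enveloping_algebra_mx aG)%MS -> gspan [set: 'S_m] a.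
Proof.
case/envelop_mxP=> f ->; apply: gspan_sum => s _.
by apply/gspanZ/gspan_delta; rewrite inE.
Qed.

(** A class sum Z is central, so it can be moved between the two factors of the
    Young symmetrizer, and therefore multiplies the symmetrizer by a scalar. *)
Lemma specht_class_average (s : 'S_m) :
  cfRepr (specht_repr nu) s *+ m`!
    = specht_dim%:R * \sum_(t : 'S_m) symmetrizer_coef (s ^ t)%g.
Proof.
pose Z : 'M[algC]_(gcard [set: 'S_m]) := \sum_(t : 'S_m) gdelta (s ^ t)%g.
have Zc a : gspan [set: 'S_m] a -> Z * a = a * Z.
  move=> Sa; apply: (gspan_comm Sa) => g _; rewrite /GRing.comm mulr_suml mulr_sumr.
  rewrite [RHS](reindex_inj (mulIg g)) /=; apply: eq_bigr => t _.
  by rewrite -!gdeltaM conjgM -conjgC.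
have sT (S : {set 'S_m}) a : gspan S a -> gspan [set: 'S_m] a.
  by apply: gspan_subset; apply: subsetT.
pose k := gcoef 1%g (young_symmetrizer nu * Z).
have ysZ : young_symmetrizer nu * Z = k *: young_symmetrizer nu.
  have eq_ys : young_symmetrizer nu * Z = row_sum * Z * col_sum.
    by rewrite young_symmetrizerE -!mulrA Zc //; apply/sT/label_sum_span.
  rewrite /k eq_ys young_symmetrizerE {1}(row_col_sum_primitive (young_filling nu)) //.
  by apply: gspan_sum => t _; apply/gspan_delta/initial_symT.
have kE : k = \sum_(t : 'S_m) symmetrizer_coef (s ^ t)%g.
  by rewrite /k mulr_sumr linear_sum.
set u := gring_row (young_symmetrizer nu).
have UZ n (v : 'M_(n, _)) : (v <= cyclic_mx aG u)%MS -> v *m Z = k *: v.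
  move=> vU; apply/row_matrixP=> i; rewrite row_mul linearZ /=.
  have /cyclic_mxP[A EA ->] := submx_trans (row_sub i v) vU.
  have AZ : A *m Z = Z *m A by rewrite !mulmxE (Zc A) //; apply: gspan_setT.
  rewrite -mulmxA AZ mulmxA -gring_row_mul mulmxE ysZ linearZ /=.
  by rewrite -scalemxAl.
have sumE : \sum_(t : 'S_m) specht_repr nu (s ^ t)%g = k%:M.
  rewrite /specht_repr /= /submod_mx -linear_sum /= -mulmx_sumr.
  rewrite (UZ _ (val_submod 1%:M)) ?val_submodP // linearZ /= val_submodK.
  by rewrite scalemx1.
rewrite [RHS]mulr_natl; have := congr1 mxtrace sumE.
rewrite mxtrace_scalar linear_sum /= kE => <-.
rewrite -card_Sn -sumr_const; apply: eq_big => [t|t _]; first by rewrite !inE.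
by rewrite -(cfunJ _ _ (in_setT t)) cfunE /= inE mulr1n.
Qed.

End SpechtCharacter.
(** * Tensor powers of irreducible representations of T *)

Section MatrixCoefficients.
Variable T : finGroupType.
Local Notation Iz := (Iirr [set: T]).
Local Notation dimz z := (irr_degree (@socle_of_Iirr T [set: T]%G z)).

Implicit Types z : Iz.

Lemma Chi1 z : 'chi_z 1%g = (dimz z)%:R.
Proof. by rewrite -irrRepr cfRepr1. Qed.

Lemma dimz_neq0 z : (dimz z)%:R != 0 :> algC.
Proof. by rewrite -Chi1 irr1_neq0. Qed.

Lemma tr_Chi (z : Iz) (t : T) : \tr ('Chi_z t) = 'chi_z t.
Proof. by rewrite -irrRepr cfunE inE mulr1n. Qed.

(** The central idempotent of z acts as 1 in z and as 0 in z'. *)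
Lemma Chi_intertwiner z z' (S : 'M_(dimz z, dimz z')) :
    (forall t, 'Chi_z t *m S = S *m 'Chi_z' t) ->
  z != z' -> S = 0.
Proof.
move=> SP ne_z.
have opS A : gring_op 'Chi_z A *m S = S *m gring_op 'Chi_z' A.
  rewrite !gring_opE [gring_row A]row_sum_delta !linear_sum mulmx_suml /=.
  apply: eq_bigr => i _; rewrite !linearZ /= -scalemxAl; congr (_ *: _).
  by rewrite /gring_mx /= -!rowE !rowK !mxvecK SP.
have := opS (Wedderburn_id (socle_of_Iirr z)).
rewrite (op_Wedderburn_id_pchar (algC'G_pchar _)) mul1mx => ->.
rewrite (irr_repr'_op0_pchar (algC'G_pchar _) _ (Wedderburn_id_mem _)) ?mulmx0 //.
by rewrite (can_eq socle_of_IirrK).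
Qed.

Lemma average_intertwiner d d' (rG : mx_representation algC [set: T] d)
    (rG' : mx_representation algC [set: T] d') (E : 'M_(d, d')) t :
  rG t *m (\sum_(y : T) rG y^-1%g *m E *m rG' y)
    = (\sum_(y : T) rG y^-1%g *m E *m rG' y) *m rG' t.
Proof.
rewrite mulmx_sumr mulmx_suml (reindex_inj (mulIg t)); apply: eq_bigr => y _.
by rewrite invMg !repr_mxM ?inE // !mulmxA -repr_mxM ?inE // mulgV repr_mx1 mul1mx.
Qed.

Lemma tr_average d (rG : mx_representation algC [set: T] d) (E : 'M_d) :
  \tr (\sum_(y : T) rG y^-1%g *m E *m rG y) = #|T|%:R * \tr E.
Proof.
rewrite linear_sum /= (eq_bigr (fun=> \tr E)) => [|y _].
  by rewrite sumr_const mulr_natl.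
by rewrite mxtrace_mulC mulmxA -repr_mxM ?inE // mulgV repr_mx1 mul1mx.
Qed.

Lemma Chi_average z z' (E : 'M_(dimz z, dimz z')) :
  z != z' -> \sum_(y : T) 'Chi_z y^-1%g *m E *m 'Chi_z' y = 0.
Proof. by move=> ne_z; apply: Chi_intertwiner ne_z => t; apply: average_intertwiner. Qed.

Lemma Chi_average_same z (E : 'M_(dimz z)) :
  \sum_(y : T) 'Chi_z y^-1%g *m E *m 'Chi_z y
    = (#|T|%:R * \tr E / (dimz z)%:R)%:M.
Proof.
have := tr_average 'Chi_z E; have := average_intertwiner 'Chi_z 'Chi_z E.
move: (\sum_y _) => S SP trS.
have /is_scalar_mxP[a defS] : is_scalar_mx S.
  apply: (@mx_abs_irr_cent_scalar _ _ _ _ 'Chi_z); first exact/groupC/socle_irr.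
  by apply/centgmxP=> t _; rewrite SP.
rewrite defS; congr (_%:M); apply: (mulIf (dimz_neq0 z)).
by rewrite mulfVK ?dimz_neq0 // -trS defS mxtrace_scalar mulr_natr.
Qed.

(** In this form a sum over y is a sum of matrices, and Schur's lemma applies. *)
Lemma average_coef d d' (rG : mx_representation algC [set: T] d)
    (rG' : mx_representation algC [set: T] d') (i j : 'I_d) (k l : 'I_d') (g h y : T) :
  rG (y^-1 * g)%g i j * rG' (y * h)%g k l
    = (rG y^-1%g *m (rG g *m delta_mx j k) *m rG' y *m rG' h) i l.
Proof.
rewrite mulmxA -[RHS]/((_ *m _) i l) -repr_mxM ?inE // -mulmxA -repr_mxM ?inE //.
rewrite -(mul_delta_mx (0 : 'I_1)) mulmxA -mulmxA mxE big_ord1.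
by rewrite -colE -rowE !mxE.
Qed.

Lemma tr_coef d (rG : mx_representation algC [set: T] d) (k j : 'I_d) g :
  \tr (rG g *m delta_mx j k) = rG g k j.
Proof.
rewrite -(mul_delta_mx (0 : 'I_1)) mulmxA mxtrace_mulC -colE -rowE.
by rewrite /mxtrace big_ord1 !mxE.
Qed.

(** Basis vectors of the direct sum of all irreducible representations. Tensors
    whose factors lie in different representations are then families of elements
    of a single type. *)
Definition irr_index : finType := {z : Iz & 'I_(dimz z)}.
Implicit Types (p q r s : irr_index) (t g h : T).

(** A matrix coefficient of t in the direct sum. *)
Definition irr_coef t p q : algC :=
  if tag q == tag p then 'Chi_(tag p) t (tagged p) (tagged_as p q) else 0.

Lemma irr_coefE t z (i j : 'I_(dimz z)) :
  irr_coef t (Tagged _ i) (Tagged _ j) = 'Chi_z t i j.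
Proof. by rewrite /irr_coef /= eqxx tagged_asE. Qed.

Lemma irr_coef0 t p q : tag p != tag q -> irr_coef t p q = 0.
Proof. by rewrite /irr_coef eq_sym => /negbTE->. Qed.

Lemma irr_coef1 p q : irr_coef 1%g p q = (p == q)%:R.
Proof.
case: p q => z i [z' j]; have [eq_z|ne_z] := eqVneq z z'.
  by case: z' / eq_z j => j; rewrite irr_coefE repr_mx1 mxE eq_Tagged.
rewrite irr_coef0 //; case: eqP => // eq_pq; case/eqP: ne_z.
exact: (congr1 tag eq_pq).
Qed.

(** Schur orthogonality: averaging y^-1 in one factor against y in another one
    exchanges the two row indices. *)
Lemma irr_coef_swap g h p q r s :
  \sum_(y : T) irr_coef (y^-1 * g) p q * irr_coef (y * h) r s
    = (tag p == tag r)%:R * (#|T|%:R / (dimz (tag r))%:R)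
      * (irr_coef g r q * irr_coef h p s).
Proof.
have [eq_pq|ne_pq] := eqVneq (tag p) (tag q); last first.
  rewrite big1 => [|y _]; last by rewrite irr_coef0 ?mul0r.
  have [eq_pr|_] := eqVneq (tag p) (tag r); last by rewrite !mul0r.
  by rewrite (irr_coef0 g) ?mul0r ?mulr0 // -eq_pr.
have [eq_rs|ne_rs] := eqVneq (tag r) (tag s); last first.
  rewrite big1 => [|y _]; last by rewrite [X in _ * X]irr_coef0 ?mulr0.
  have [eq_pr|_] := eqVneq (tag p) (tag r); last by rewrite !mul0r.
  by rewrite (irr_coef0 h) ?mulr0 // eq_pr.
case: p q r s eq_pq eq_rs => z i [zq j] [z' k] [zs l] /= eq_zq eq_zs.
case: zq / eq_zq j => j; case: zs / eq_zs l => l.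
pose E := 'Chi_z g *m delta_mx j k.
transitivity ((\sum_(y : T) 'Chi_z y^-1%g *m E *m 'Chi_z' y *m 'Chi_z' h) i l).
  by rewrite summxE; apply: eq_bigr => y _; rewrite !irr_coefE average_coef.
rewrite -mulmx_suml; have [eq_z|ne_z] := eqVneq z z'; last first.
  by rewrite Chi_average // mul0mx mxE !mul0r.
case: z' / eq_z k l @E => k l E.
rewrite Chi_average_same mul_scalar_mx mxE !irr_coefE mul1r.
rewrite tr_coef.
by rewrite [_ * _ / _]mulrAC -!mulrA.
Qed.

End MatrixCoefficients.
Section ColoredTrace.
Variable T : finGroupType.
Local Notation Iz := (Iirr [set: T]).
Local Notation dimz z := (irr_degree (@socle_of_Iirr T [set: T]%G z)).
Local Notation index := (irr_index T).

(** The diagonal coefficient at the pure tensor a of the action of w on a tensor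
    power of the sum of all irreducible representations. *)
Definition wreath_coef N (a : {ffun 'I_N -> index}) (w : wreath T N) : algC :=
  \prod_i irr_coef (wbase w i) (a i) (a (wtop w i)).

Section JucysMurphyTrace.
Variable n : nat.
Implicit Types (a : {ffun 'I_n.+1 -> index}) (w : wreath T n.+1) (M : walg T n.+1).
Implicit Type F : 'S_n.+1 -> algC.

Definition jm_term (i : 'I_n) (y : T) : wreath T n.+1 :=
  (wentry y^-1 (lift ord_max i) * wentry y ord_max
     * wtransp T (lift ord_max i) ord_max)%g.

Lemma wtop_jm_term i y : wtop (jm_term i y) = tperm (lift ord_max i) ord_max.
Proof. by rewrite /jm_term !wtopM /= !mul1g. Qed.

Lemma wbase_jm_term i y j : wbase (jm_term i y) j =
  if j == lift ord_max i then (y^-1)%g else if j == ord_max then y else 1%g.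
Proof.
rewrite /= !ffunE /= !perm1 mulg1.
have [->|_] := eqVneq j (lift ord_max i); last by rewrite mul1g.
by rewrite eq_sym (negbTE (neq_lift _ _)) mulg1.
Qed.

(** On a tensor power the sum over y acts on two factors of the same type as a
    multiple of their exchange, which undoes the exchange by the transposition;
    it vanishes on factors of different types. *)
Lemma wreath_coef_jm a i w :
  \sum_(y : T) wreath_coef a (jm_term i y * w)%g
    = (tag (a (lift ord_max i)) == tag (a ord_max))%:R
      * (#|T|%:R / (dimz (tag (a ord_max)))%:R) * wreath_coef a w.
Proof.
set i' := lift ord_max i; have ne_i' : i' != ord_max by rewrite eq_sym neq_lift.
pose R := \prod_(j | (j != ord_max) && (j != i')) irr_coef (wbase w j) (a j) (a (wtop w j)).
have -> : wreath_coef a w = irr_coef (wbase w ord_max) (a ord_max) (a (wtop w ord_max))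
    * irr_coef (wbase w i') (a i') (a (wtop w i')) * R.
  by rewrite /wreath_coef (bigD1 ord_max) //= (bigD1 i') //= mulrA.
have coefE y : wreath_coef a (jm_term i y * w)%g =
    irr_coef (y^-1 * wbase w ord_max)%g (a i') (a (wtop w ord_max))
    * irr_coef (y * wbase w i')%g (a ord_max) (a (wtop w i')) * R.
  have baseM j : wbase (jm_term i y * w)%g j
      = (wbase (jm_term i y) j * wbase w (tperm i' ord_max j))%g.
    by rewrite ffunE wtop_jm_term.
  have topM j : wtop (jm_term i y * w)%g j = wtop w (tperm i' ord_max j).
    by rewrite wtopM wtop_jm_term permM.
  move: (jm_term i y * w)%g baseM topM => W baseM topM.
  rewrite /wreath_coef (bigD1 ord_max) //= (bigD1 i') //= mulrA.
  rewrite !baseM !topM !wbase_jm_term -/i' tpermL tpermR !eqxx.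
  rewrite [ord_max == i']eq_sym (negbTE ne_i').
  congr (_ * _); first by rewrite mulrC.
  apply: eq_bigr => j /andP[ne_max ne_j].
  rewrite baseM topM wbase_jm_term -/i' (negbTE ne_j) (negbTE ne_max) mul1g.
  by rewrite tpermD // eq_sym.
under eq_bigr => y _ do rewrite coefE.
by rewrite -mulr_suml irr_coef_swap !mulrA.
Qed.

(** The weight F on permutations is there to carry the coefficients of a Young
    symmetrizer along the computation on tensors. *)
Definition wreath_trace a F M : algC :=
  \sum_(w : wreath T n.+1) gcoef w M * (F (wtop w) * wreath_coef a w).

Lemma wreath_trace_is_linear a F : linear_for *%R (wreath_trace a F).
Proof.
move=> x A B; rewrite /wreath_trace mulr_sumr -big_split /=; apply: eq_bigr => w _.
by rewrite linearP /= mulrDl -mulrA.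
Qed.

HB.instance Definition _ a F :=
  GRing.isLinear.Build algC (walg T n.+1) algC *%R (wreath_trace a F)
    (wreath_trace_is_linear a F).

Lemma wreath_trace_delta a F w :
  wreath_trace a F (gdelta w) = F (wtop w) * wreath_coef a w.
Proof.
rewrite /wreath_trace (bigD1 w) //= gcoef_delta eqxx mul1r big1 ?addr0 // => v.
by rewrite gcoef_delta eq_sym => /negbTE->; rewrite mul0r.
Qed.

(** Multiplication by the Jucys-Murphy element of the symmetric group, restricted
    to the transpositions selected by l, seen on functions. *)
Definition color_step (l : pred 'I_n) F (s : 'S_n.+1) : algC :=
  \sum_(i : 'I_n | l i) F (tperm (lift ord_max i) ord_max * s)%g.

Definition last_color a : pred 'I_n :=
  fun i => tag (a (lift ord_max i)) == tag (a ord_max).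

Lemma jucys_murphyE :
  jucys_murphy T n = \sum_(i < n) \sum_(y : T) gdelta (jm_term i y).
Proof. by []. Qed.

(** On tensors the base group T^n only contributes a scalar to jucys_murphy, and
    what remains is a Jucys-Murphy element acting on the weight, in which the last
    point is exchanged only with points of its own colour. *)
Lemma wreath_trace_jm a F M : gspan [set: wreath T n.+1] M ->
  wreath_trace a F (jucys_murphy T n * M)
    = #|T|%:R / (dimz (tag (a ord_max)))%:R
      * wreath_trace a (color_step (last_color a) F) M.
Proof.
elim=> [|x w {}M _ _ IH]; first by rewrite mulr0 !linear0 mulr0.
rewrite mulrDr !linearD /= mulrDr IH; congr (_ + _).
rewrite galg_scaler !linearZ /= mulrCA; congr (_ * _).
rewrite jucys_murphyE mulr_suml linear_sum wreath_trace_delta /color_step.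
rewrite mulr_suml mulr_sumr [RHS]big_mkcond; apply: eq_bigr => i _ /=.
rewrite mulr_suml linear_sum /=.
under eq_bigr => y _ do rewrite -gdeltaM wreath_trace_delta wtopM wtop_jm_term.
rewrite -mulr_sumr wreath_coef_jm -/(last_color a i).
by case: ifP => _; rewrite ?mul0r ?mulr0 // mul1r mulrCA.
Qed.

Lemma wreath_trace_jmX a F M k : gspan [set: wreath T n.+1] M ->
  wreath_trace a F (jucys_murphy T n ^+ k * M)
    = (#|T|%:R / (dimz (tag (a ord_max)))%:R) ^+ k
      * wreath_trace a (iter k (color_step (last_color a)) F) M.
Proof.
move=> SM; elim: k F => [|k IH] F; first by rewrite !expr0 !mul1r.
have SJ : gspan [set: wreath T n.+1] (jucys_murphy T n).
  apply: gspan_sum => i _; apply: gspan_sum => y _.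
  by apply: gspan_delta; rewrite inE.
rewrite exprS -mulrA wreath_trace_jm.
  by rewrite IH iterSr mulrA -exprS.
by apply: gspanM => //; apply: gspanX.
Qed.

Lemma wreath_trace_class a F (C : {set T}) :
  wreath_trace a F (class_last n C)
    = F 1%g * \sum_(x in C) irr_coef x (a ord_max) (a ord_max).
Proof.
rewrite /class_last linear_sum mulr_sumr; apply: eq_bigr => x _ /=.
rewrite wreath_trace_delta /wreath_coef /=; congr (_ * _).
rewrite (bigD1 ord_max) //= ffunE eqxx perm1 big1 ?mulr1 // => i /negbTE ne_i.
by rewrite ffunE ne_i perm1 irr_coef1 eqxx.
Qed.

End JucysMurphyTrace.

Section Restriction.
Variable n : nat.
Implicit Types (a : {ffun 'I_n -> index}) (p : index).

Definition ext_last a p : {ffun 'I_n.+1 -> index} :=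
  [ffun j => if unlift ord_max j is Some i then a i else p].

Lemma ext_last_max a p : ext_last a p ord_max = p.
Proof. by rewrite ffunE unlift_none. Qed.

Lemma ext_last_lift a p i : ext_last a p (lift ord_max i) = a i.
Proof. by rewrite ffunE liftK. Qed.

Definition strip_last (w : wreath T n.+1) (s : 'S_n) : wreath T n :=
  Wreath [ffun i => wbase w (lift ord_max i)] s.

Lemma wreath_coef_ext a p (w : wreath T n.+1) (s : 'S_n) :
    wtop w = lift_perm ord_max ord_max s ->
  wreath_coef (ext_last a p) w
    = irr_coef (wbase w ord_max) p p * wreath_coef a (strip_last w s).
Proof.
move=> def_w; rewrite /wreath_coef (bigD1_ord ord_max) //= def_w.
rewrite lift_perm_id ext_last_max; congr (_ * _); apply: eq_bigr => i _.
by rewrite lift_perm_lift !ext_last_lift ffunE.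
Qed.

Lemma sum_irr_index (G : index -> algC) :
  \sum_p G p = \sum_z \sum_(i < dimz z) G (Tagged (fun z => 'I_(dimz z)) i).
Proof.
by rewrite sig_big_dep /=; apply: eq_big => [[z i]|[z i] _].
Qed.

(** The regular character of T, decomposed into irreducible characters. *)
Lemma sum_irr_coef_diag (t : T) :
  \sum_p (dimz (tag p))%:R / #|T|%:R * irr_coef t p p = (t == 1%g)%:R.
Proof.
have nzT : #|T|%:R != 0 :> algC by rewrite -cardsT neq0CG.
transitivity ((cfReg [set: T] t) / #|T|%:R).
  rewrite cfReg_sum sum_cfunE mulr_suml.
  rewrite sum_irr_index.
  apply: eq_bigr => z _; rewrite cfunE Chi1 -tr_Chi mulrAC /mxtrace mulr_sumr.
  by apply: eq_bigr => i _; rewrite irr_coefE.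
rewrite cfRegE cardsT; case: (t == 1%g); last by rewrite mulr0n mul0r.
by rewrite mulr1n mulfV.
Qed.

(** Extension by zero to the permutations that move the last point. *)
Definition lift_fun (F : 'S_n -> algC) (s : 'S_n.+1) : algC :=
  \sum_(t : 'S_n | lift_perm ord_max ord_max t == s) F t.

Lemma lift_perm_max_inj : injective (@lift_perm n ord_max ord_max).
Proof.
move=> s t eq_st; apply/permP=> i; apply: (@lift_inj _ ord_max).
by rewrite -!(lift_perm_lift ord_max) eq_st.
Qed.

Lemma lift_fun_lift F s : lift_fun F (lift_perm ord_max ord_max s) = F s.
Proof.
rewrite /lift_fun (big_pred1 s) // => t.
by rewrite (inj_eq lift_perm_max_inj).
Qed.

(** Reading a coefficient at the identity of the last copy of T is averaging
    over all irreducible representations placed there, weighted by dimension. *)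
Lemma wreath_trace_restr (P : pred {ffun 'I_n -> index}) F (M : walg T n.+1) :
  \sum_(g : wreath T n) gcoef (wreath_incl g) M
      * (F (wtop g) * \sum_(a | P a) wreath_coef a g)
    = \sum_(a | P a) \sum_p (dimz (tag p))%:R / #|T|%:R
        * wreath_trace (ext_last a p) (lift_fun F) M.
Proof.
pose G g := F (wtop g) * \sum_(a | P a) wreath_coef a g.
have locE (w : wreath T n.+1) :
    \sum_(a | P a) \sum_p (dimz (tag p))%:R / #|T|%:R
        * (lift_fun F (wtop w) * wreath_coef (ext_last a p) w)
    = \sum_(g : wreath T n | wreath_incl g == w) G g.
  case: (pickP (fun s : 'S_n => lift_perm ord_max ord_max s == wtop w)) => [s /eqP def_w|no_s].
    rewrite -def_w lift_fun_lift.
    transitivity ((wbase w ord_max == 1%g)%:R * G (strip_last w s)).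
      rewrite exchange_big /= /G -sum_irr_coef_diag mulr_suml; apply: eq_bigr => p _.
      rewrite mulrA mulr_sumr; apply: eq_bigr => a _.
      by rewrite (wreath_coef_ext _ _ (esym def_w)); ring.
    have inclE g : wreath_incl g == w -> g = strip_last w s.
      case: g => b t /eqP def_g; rewrite -def_g in def_w *.
      rewrite (lift_perm_max_inj def_w); congr Wreath.
      by apply/ffunP=> i; rewrite !ffunE liftK.
    have [w1|ne_w1] := eqVneq (wbase w ord_max) 1%g; last first.
      rewrite mul0r big_pred0 // => g; apply: contraNF ne_w1 => /eqP<-.
      by rewrite /= ffunE unlift_none.
    rewrite mul1r (big_pred1 (strip_last w s)) // => g /=.
    apply/idP/eqP => [/inclE//|->]; apply/eqP.
    case: w def_w w1 {inclE} => b t /= def_w w1.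
    rewrite /wreath_incl /= def_w; congr Wreath; apply/ffunP=> j; rewrite ffunE.
    by case: unliftP => [i|] ->; rewrite ?ffunE.
  have F0 : lift_fun F (wtop w) = 0 by apply: big_pred0 => t; apply: no_s.
  rewrite [RHS]big_pred0 => [|g].
    by rewrite big1 // => a _; rewrite big1 // => p _; rewrite F0 mul0r mulr0.
  apply/eqP=> def_w; have := no_s (wtop g).
  by rewrite -def_w /= eqxx.
transitivity (\sum_(w : wreath T n.+1)
    gcoef w M * \sum_(g : wreath T n | wreath_incl g == w) G g).
  under [RHS]eq_bigr => w _ do rewrite mulr_sumr big_mkcond.
  rewrite exchange_big /=; apply: eq_bigr => g _.
  by rewrite -big_mkcond (big_pred1 (wreath_incl g)) // => w; rewrite eq_sym.
under eq_bigr => w _ do rewrite -locE mulr_sumr.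
rewrite exchange_big; apply: eq_bigr => a _ /=.
under eq_bigr => w _ do rewrite mulr_sumr.
rewrite exchange_big; apply: eq_bigr => p _ /=.
by rewrite /wreath_trace mulr_sumr; apply: eq_bigr => w _; rewrite mulrCA.
Qed.

End Restriction.

End ColoredTrace.
Lemma eq_iter_color_step n (l l' : pred 'I_n) F k (s : 'S_n.+1) :
  l =1 l' -> iter k (color_step l) F s = iter k (color_step l') F s.
Proof.
move=> eq_l; elim: k s => //= k IH s.
by rewrite /color_step (eq_bigl _ _ eq_l); apply: eq_bigr => i _; apply: IH.
Qed.

Lemma lift_perm_stab n (s : 'S_n.+1) : s ord_max = ord_max ->
  exists s0 : 'S_n, lift_perm ord_max ord_max s0 = s.
Proof.
move=> s_max; pose f (i : 'I_n) := odflt i (unlift ord_max (s (lift ord_max i))).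
have fE i : lift ord_max (f i) = s (lift ord_max i).
  rewrite /f; case: unliftP => [j -> //|/eqP].
  by rewrite -{2}s_max (inj_eq perm_inj) eq_sym (negbTE (neq_lift _ _)).
have f_inj : injective f.
  by move=> i i' /(congr1 (lift ord_max)); rewrite !fE => /perm_inj/lift_inj.
exists (perm f_inj); apply/permP=> j.
case: (unliftP ord_max j) => [i|] ->; last by rewrite lift_perm_id s_max.
by rewrite lift_perm_lift permE fE.
Qed.

Section ColoredRestriction.
Variables (T : finGroupType) (n : nat) (col : 'I_n -> Iirr [set: T]).
Local Notation dimz z := (irr_degree (@socle_of_Iirr T [set: T]%G z)).
Local Notation index := (irr_index T).

Definition has_color (a : {ffun 'I_n -> index}) := [forall i, tag (a i) == col i].

(** The trace of g on the tensor product whose i-th factor is col i, extended by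
    zero to the elements g that do not preserve colours. *)
Definition color_trace (g : wreath T n) : algC :=
  \sum_(a | has_color a) wreath_coef a g.

Lemma color_trace1 : color_trace 1%g = #|has_color|%:R.
Proof.
rewrite /color_trace -sum1_card natr_sum; apply: eq_bigr => a _.
by apply: big1 => i _; rewrite ffunE perm1 irr_coef1 eqxx.
Qed.

(** Place an arbitrary irreducible z at the last point; the sum over its basis of
    the elements of C gives the values of the character of z. *)
Lemma color_trace_jm F k (C : {set T}) :
  \sum_(g : wreath T n) gcoef (wreath_incl g) (jucys_murphy T n ^+ k * class_last n C)
      * (F (wtop g) * color_trace g)
    = color_trace 1%g * \sum_(z : Iirr [set: T])
        (dimz z)%:R / #|T|%:R * (#|T|%:R / (dimz z)%:R) ^+ k
        * iter k (color_step (fun i => col i == z)) (lift_fun F) 1%g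
        * \sum_(x in C) 'chi_z x.
Proof.
rewrite wreath_trace_restr color_trace1.
have -> : #|has_color|%:R = \sum_(a | has_color a) 1 :> algC by rewrite -sum1_card natr_sum.
rewrite mulr_suml.
apply: eq_bigr => a /forallP a_col; rewrite mul1r.
rewrite sum_irr_index; apply: eq_bigr => z _.
have SA : gspan [set: wreath T n.+1] (class_last n C).
  by apply: gspan_sum => x _; apply: gspan_delta; rewrite inE.
transitivity (\sum_(i < dimz z) (dimz z)%:R / #|T|%:R * (#|T|%:R / (dimz z)%:R) ^+ k
    * iter k (color_step (fun i => col i == z)) (lift_fun F) 1%g
    * \sum_(x in C) 'Chi_z x i i).
  apply: eq_bigr => i _; rewrite wreath_trace_jmX // wreath_trace_class ext_last_max /=.
  rewrite !mulrA; congr (_ * _ * _).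
    apply: eq_iter_color_step => j.
    by rewrite /last_color ext_last_max ext_last_lift (eqP (a_col j)).
  by apply: eq_bigr => x _; rewrite irr_coefE.
rewrite -mulr_sumr exchange_big /=; congr (_ * _); apply: eq_bigr => x _.
by rewrite -tr_Chi.
Qed.

End ColoredRestriction.

Section Transport.
Variables (m n : nat) (e : 'I_m -> 'I_n) (F : 'S_n -> algC) (f : 'S_m -> algC).
Hypothesis e_inj : injective e.

Definition conjugate_along m n (e : 'I_m -> 'I_n) (t : 'S_m) (s : 'S_n) :=
  (forall p, s (e p) = e (t p)) /\ (forall i, i \notin codom e -> s i = i).

Hypothesis Ff : forall t s, conjugate_along e t s -> F s = f t.

Definition ext_max (j : 'I_m.+1) : 'I_n.+1 :=
  if unlift ord_max j is Some p then lift ord_max (e p) else ord_max.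

Lemma ext_max_max : ext_max ord_max = ord_max.
Proof. by rewrite /ext_max unlift_none. Qed.

Lemma ext_max_lift p : ext_max (lift ord_max p) = lift ord_max (e p).
Proof. by rewrite /ext_max liftK. Qed.

Lemma ext_max_inj : injective ext_max.
Proof.
move=> j j'; rewrite /ext_max; case: unliftP => [p|] ->; case: unliftP => [p'|] -> //.
- by move/lift_inj/e_inj->.
- by move/esym/eqP; rewrite (negbTE (neq_lift _ _)).
by move/eqP; rewrite (negbTE (neq_lift _ _)).
Qed.

Lemma codom_ext_max i : (lift ord_max i \in codom ext_max) = (i \in codom e).
Proof.
apply/codomP/codomP => [[j]|[p ->]]; last by exists (lift ord_max p); rewrite ext_max_lift.
rewrite /ext_max; case: unliftP => [p _ /lift_inj->|_ /esym/eqP]; first by exists p.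
by rewrite (negbTE (neq_lift _ _)).
Qed.

Lemma lift_fun_transport t s :
  conjugate_along ext_max t s -> lift_fun F s = lift_fun f t.
Proof.
case=> st s_out.
case: (pickP (fun t0 : 'S_m => lift_perm ord_max ord_max t0 == t)) => [t0 /eqP def_t|no_t].
  have s_max : s ord_max = ord_max.
    by rewrite -ext_max_max st -def_t lift_perm_id.
  have [s0 def_s] := lift_perm_stab s_max.
  rewrite -def_s -def_t !lift_fun_lift; apply: Ff; split=> [p|i i_out].
    apply: (@lift_inj _ ord_max); rewrite -(lift_perm_lift ord_max) def_s -ext_max_lift st.
    by rewrite -def_t lift_perm_lift ext_max_lift.
  apply: (@lift_inj _ ord_max); rewrite -(lift_perm_lift ord_max) def_s s_out //.
  by rewrite codom_ext_max.
rewrite /lift_fun [RHS]big_pred0 // big_pred0 // => s0; apply/eqP=> def_s.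
have t_max : t ord_max = ord_max.
  by apply: ext_max_inj; rewrite -st ext_max_max -def_s lift_perm_id.
have [t0 def_t] := lift_perm_stab t_max.
by have := no_t t0; rewrite def_t eqxx.
Qed.

(** Exchanges of the last point with points of one colour only involve that colour
    class, so they can be carried out in the symmetric group of the class. *)
Lemma color_step_transport k t s : conjugate_along ext_max t s ->
  iter k (color_step [in codom e]) (lift_fun F) s
    = iter k (color_step xpredT) (lift_fun f) t.
Proof.
elim: k t s => [|k IH] t s ts /=; first exact: lift_fun_transport.
rewrite /color_step (eq_bigl [in e @: 'I_m]) => [|i]; last first.
  by apply/codomP/imsetP => [[p ->]|[p _ ->]]; exists p.
rewrite big_imset /=; last by move=> p p' _ _; apply: e_inj.
apply: eq_big => // p _; apply: IH; case: ts => st s_out.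
have -> : tperm (lift ord_max (e p)) ord_max
    = tperm (ext_max (lift ord_max p)) (ext_max ord_max).
  by rewrite ext_max_lift ext_max_max.
split=> [j|i i_out]; first by rewrite !permM -(inj_tperm _ _ _ ext_max_inj) st.
by rewrite permM tpermD ?s_out //; apply: contraNneq i_out => <-; apply: codom_f.
Qed.

End Transport.

Section YoungSymmetrizerLift.
Variable nu : young.
Local Notation m := (boxes nu).
Local Notation r := (reshape_index nu).
Local Notation c := (reshape_offset nu).
Local Notation mx := (ord_max : 'I_m.+1).

Lemma label_stab_lift l (s : 'S_m) :
  (lift_perm mx mx s \in label_stab m.+1 l m) = (s \in label_stab m l m).
Proof.
apply/label_stabP/label_stabP => -[sG sl]; split.
- exact: initial_symT.
- by move=> i; rewrite -(lift_max i) -(lift_max (s i)) -(lift_perm_lift mx mx) sl.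
- apply/initial_symP=> i; case: (unliftP mx i) => [j|] ->; last by rewrite lift_perm_id.
  by rewrite lift_max leqNgt ltn_ord.
move=> i; case: (unliftP mx i) => [j|] ->; last by rewrite lift_perm_id.
by rewrite lift_perm_lift !lift_max.
Qed.

Lemma label_sum_lift l e : label_sum m.+1 l m e
  = \sum_(s in label_stab m l m) (-1) ^+ (e && odd_perm s) *: gdelta (lift_perm mx mx s).
Proof.
rewrite /label_sum (eq_bigl [in @lift_perm m mx mx @: label_stab m l m]) => [|s].
  rewrite big_imset /=; last by move=> s t _ _; apply: lift_perm_max_inj.
  by apply: eq_bigr => s _; rewrite odd_lift_perm addbb.
apply/idP/imsetP => [sl|[s0 s0l ->]]; last by rewrite label_stab_lift.
have [|s0 def_s] := @lift_perm_stab m s.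
  by case/label_stabP: sl => /initial_symP/(_ mx); rewrite leqnn => ->.
by exists s0; rewrite -?label_stab_lift def_s.
Qed.

Lemma gcoef1_lift (s : 'S_m.+1) :
  gcoef 1%g (label_sum m.+1 r m false * label_sum m.+1 c m true * gdelta s)
    = lift_fun (@symmetrizer_coef nu) s.
Proof.
case: (eqVneq (s mx) mx) => [/lift_perm_stab[s0 <-]|s_max]; last first.
  rewrite [RHS]big_pred0 => [|s0]; last first.
    by apply: contraNF s_max => /eqP<-; rewrite lift_perm_id.
  rewrite -[_ * gdelta s]mulr1; apply: (@gcoef1_outside _ m).
  - by apply: gspanM; apply: label_sum_span.
  - exact: gspan1.
  by apply: contra s_max => /initial_symP->.
rewrite lift_fun_lift /symmetrizer_coef young_symmetrizerE !label_sum_lift /label_sum.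
rewrite !mulr_suml !linear_sum; apply: eq_bigr => p _ /=.
rewrite !mulr_sumr !mulr_suml !linear_sum; apply: eq_bigr => q _ /=.
rewrite !(galg_scaler, galg_scalel) !linearZ /= -!gdeltaM !gcoef_delta !lift_permM.
by rewrite -(lift_perm1 mx) (inj_eq (@lift_perm_max_inj _)).
Qed.

Lemma jucys_max : jucys mx = \sum_(p < m) gdelta (tperm (lift mx p) mx).
Proof.
rewrite /jucys big_mkcond (bigD1_ord mx) //= ltnn add0r.
by apply: eq_bigr => p _; rewrite /bump (leqNgt m p) ltn_ord /= add0n ltn_ord.
Qed.

(** jucys_moment with the last point as the box to be added: multiplying by
    transpositions of this point k times is multiplying by jucys ^+ k. *)
Lemma color_step_symmetrizer k :
  iter k (color_step xpredT) (lift_fun (@symmetrizer_coef nu)) 1%g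
    = jucys_moment r c mx k.
Proof.
pose x := label_sum m.+1 r m false; pose y := label_sum m.+1 c m true.
have stepE s : iter k (color_step xpredT) (lift_fun (@symmetrizer_coef nu)) s
    = gcoef 1%g (x * y * jucys mx ^+ k * gdelta s).
  elim: k s => [|k IH] s /=; first by rewrite expr0 mulr1 gcoef1_lift.
  rewrite /color_step; under eq_bigr => p _ do rewrite IH gdeltaM mulrA.
  rewrite exprSr [in RHS]mulrA [X in _ * X * gdelta s]jucys_max.
  move: (x * y * _) => z.
  by rewrite mulr_sumr mulr_suml linear_sum.
rewrite stepE gdelta1 mulr1 /jucys_moment -/x -/y -!mulrA; congr (gcoef _ (_ * _)).
by apply/commrX/commr_sym/jucys_comm/label_sum_span.
Qed.

End YoungSymmetrizerLift.
(** * Characters of the Young subgroups *)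

Lemma sum_dffun_prod (I : finType) (T_ : I -> finType) (F : forall i, T_ i -> algC) :
  \sum_(k : {dffun forall i, T_ i}) \prod_i F i (k i) = \prod_i \sum_(t : T_ i) F i t.
Proof.
rewrite (reindex (@dffun_of_fprod I T_)); last exact/onW_bij/dffun_of_fprod_bij.
pose P_ i := [ffun t : T_ i => F i t].
transitivity (\sum_(t : fprod T_) \prod_(i in I) P_ i (t i)).
  by apply: eq_bigr => t _; apply: eq_bigr => i _; rewrite !ffunE.
rewrite big_fprod.
transitivity (\prod_i \sum_(j in tagged_with T_ i) untag 0 (P_ i) j).
  by rewrite bigA_distr_big_dep.
apply: eq_bigr => i _; rewrite -(big_tag (fun i => P_ i : T_ i -> algC)).
by apply: eq_bigr => t _; rewrite ffunE.
Qed.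

Section Blocks.
Variables (T : finGroupType) (n : nat) (lam : multidiagram T n).
Local Notation Iz := (Iirr [set: T]).
Local Notation dimz z := (irr_degree (@socle_of_Iirr T [set: T]%G z)).
Local Notation index := (irr_index T).
Local Notation m z := (boxes (lam z)).
Local Notation K := (block_prod lam).
Local Notation pos := (fun z => 'I_(m z)).
Implicit Types h u : K.

Definition block_color (i : 'I_n) : Iz := tag (block_of lam i).

Definition in_block z (p : 'I_(m z)) : 'I_n := of_block (lam := lam) (Tagged pos p).

Lemma in_block_inj z : injective (@in_block z).
Proof.
move=> p p' /(can_inj (@of_blockK _ _ lam))/eqP.
by rewrite eq_Tagged => /eqP.
Qed.

Lemma codom_in_block z i : (i \in codom (@in_block z)) = (block_color i == z).
Proof.
apply/codomP/eqP => [[p ->]|<-]; first by rewrite /block_color of_blockK.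
exists (tagged (block_of lam i)); rewrite /in_block /block_color.
by rewrite -[LHS](block_ofK lam) ; case: (block_of lam i).
Qed.

Lemma wtop_block_emb h z p : wtop (block_emb h) (in_block p) = in_block (wtop (h z) p).
Proof. by rewrite permE /= of_blockK. Qed.

Lemma wbase_block_emb h z (p : 'I_(m z)) :
  wbase (block_emb h) (in_block p) = wbase (h z) p.
Proof. by rewrite ffunE of_blockK. Qed.

Lemma ord_block_ind (P : 'I_n -> Prop) :
  (forall z (p : 'I_(m z)), P (in_block p)) -> forall i, P i.
Proof.
by move=> Pb i; rewrite -(block_ofK lam i); case: (block_of lam i).
Qed.

Lemma prod_blocks (F : 'I_n -> algC) :
  \prod_i F i = \prod_z \prod_(p < m z) F (in_block p).
Proof.
rewrite sig_big_dep /= (reindex (@of_block _ _ lam)); last first.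
  by exists (@block_of _ _ lam) => i _; [apply: of_blockK | apply: block_ofK].
by apply: eq_big => [[z p]|[z p] _].
Qed.

Lemma wtop_block_emb_inj h u : wtop (block_emb h) = wtop (block_emb u) ->
  forall z, wtop (h z) = wtop (u z).
Proof.
move=> eq_top z; apply/permP=> p; apply: (@in_block_inj z).
by rewrite -!wtop_block_emb eq_top.
Qed.

Lemma tr_tpow z (w : wreath T (m z)) : \tr (tpow_repr (m z) 'Chi_z w)
  = \sum_(c : {ffun 'I_(m z) -> 'I_(dimz z)})
      \prod_i 'Chi_z (wbase w i) (c i) (c (wtop w i)).
Proof.
rewrite /mxtrace (reindex (@enum_rank {ffun 'I_(m z) -> 'I_(dimz z)})) /=; last first.
  exact/onW_bij/enum_rank_bij.
by apply: eq_bigr => a _; rewrite mxE; apply: eq_bigr => i _; rewrite !enum_rankK.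
Qed.

(** The default value is never met on tensors of the right colours. *)
Definition retag z (q : index) : 'I_(dimz z) :=
  tagged_as (Tagged (fun z => 'I_(dimz z))
    (Ordinal (irr_degree_gt0 (socle_of_Iirr z)))) q.

(** A tensor of the right colours is a family of tensors, one in each block, and
    matrix coefficients multiply over the blocks. *)
Lemma color_trace_block h :
  color_trace block_color (block_emb h) = \prod_z \tr (tpow_repr (m z) 'Chi_z (h z)).
Proof.
under [RHS]eq_bigr => z _ do rewrite tr_tpow.
rewrite -(sum_dffun_prod (fun z (c : {ffun 'I_(m z) -> 'I_(dimz z)}) =>
  \prod_i 'Chi_z (wbase (h z) i) (c i) (c (wtop (h z) i)))).
pose tensor (c : {dffun forall z, {ffun 'I_(m z) -> 'I_(dimz z)}}) : {ffun 'I_n -> index} :=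
  [ffun i => let b := block_of lam i in
     Tagged (fun z => 'I_(dimz z)) (c (tag b) (tagged b))].
pose tensorV (a : {ffun 'I_n -> index}) : {dffun forall z, {ffun 'I_(m z) -> 'I_(dimz z)}} :=
  [ffun z => [ffun p => retag z (a (in_block p))]].
have tensorE c z (p : 'I_(m z)) :
    tensor c (in_block p) = Tagged (fun z => 'I_(dimz z)) (c z p).
  by rewrite ffunE of_blockK.
rewrite /color_trace (reindex_onto tensor tensorV) /=; last first.
  move=> a /forallP a_col; apply/ffunP; apply: ord_block_ind => z p.
  rewrite tensorE !ffunE /retag; have := a_col (in_block p).
  rewrite /block_color of_blockK /=; case: (a _) => z' j /= /eqP eq_z.
  by case: z / eq_z p => p; rewrite tagged_asE.
apply: eq_big => [c|c _].
  apply/andP; split.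
    by apply/forallP; apply: ord_block_ind => z p; rewrite tensorE /block_color of_blockK.
  apply/eqP/ffunP=> z; apply/ffunP=> p; rewrite !ffunE of_blockK.
  by rewrite /retag /= tagged_asE.
rewrite /wreath_coef prod_blocks; apply: eq_bigr => z _; apply: eq_bigr => p _.
by rewrite wtop_block_emb wbase_block_emb !tensorE irr_coefE.
Qed.

End Blocks.
Section CentralElement.
Variables (T : finGroupType) (n : nat).

Lemma wreath_eq N (u v : wreath T N) : wbase u =1 wbase v -> wtop u = wtop v -> u = v.
Proof. by case: u v => [f s] [g t] /= /ffunP-> ->. Qed.

Lemma wbase_incl_lift (u : wreath T n) i :
  wbase (wreath_incl u) (lift ord_max i) = wbase u i.
Proof. by rewrite ffunE liftK. Qed.

Lemma wbase_incl_max (u : wreath T n) : wbase (wreath_incl u) ord_max = 1%g.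
Proof. by rewrite ffunE unlift_none. Qed.

Lemma wtop_incl_lift (u : wreath T n) i :
  wtop (wreath_incl u) (lift ord_max i) = lift ord_max (wtop u i).
Proof. exact: lift_perm_lift. Qed.

Lemma wtop_incl_max (u : wreath T n) : wtop (wreath_incl u) ord_max = ord_max.
Proof. exact: lift_perm_id. Qed.

Lemma wreath_inclM : {morph @wreath_incl T n : u v / (u * v)%g}.
Proof.
move=> u v; apply: wreath_eq => [j|]; last by rewrite /= lift_permM.
rewrite [RHS]ffunE; case: (unliftP ord_max j) => [i|] ->.
  by rewrite !wbase_incl_lift /= lift_perm_lift wbase_incl_lift ffunE.
by rewrite !wbase_incl_max /= lift_perm_id wbase_incl_max mulg1.
Qed.

(** Conjugation by u permutes the terms of the Jucys-Murphy element. *)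
Lemma jm_term_incl (u : wreath T n) i y :
  (jm_term i y * wreath_incl u
    = wreath_incl u * jm_term (wtop u i) (y * wbase u i))%g.
Proof.
apply: wreath_eq => [j|]; last first.
  rewrite wtopM [RHS]wtopM !wtop_jm_term /= conjgC tpermJ lift_perm_lift lift_perm_id.
  by [].
have baseM (U V : wreath T n.+1) : wbase (U * V)%g j = (wbase U j * wbase V (wtop U j))%g.
  by rewrite ffunE.
rewrite baseM [RHS]baseM !wbase_jm_term wtop_jm_term.
case: (unliftP ord_max j) => [k|] ->; last first.
  rewrite (negbTE (neq_lift _ _)) eqxx tpermR wbase_incl_lift wbase_incl_max mul1g.
  by rewrite wtop_incl_max (negbTE (neq_lift _ _)) eqxx.
rewrite wbase_incl_lift wtop_incl_lift !(inj_eq (@lift_inj _ _)) (inj_eq perm_inj).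
rewrite ![lift ord_max _ == ord_max]eq_sym !(negbTE (neq_lift _ _)).
have [->|ne_k] := eqVneq k i.
  by rewrite tpermL wbase_incl_max mulg1 invMg mulKVg.
rewrite tpermD ?neq_lift // ?(inj_eq (@lift_inj _ _)) 1?eq_sym //.
by rewrite wbase_incl_lift mul1g mulg1.
Qed.

Lemma jucys_murphy_comm (u : wreath T n) :
  GRing.comm (jucys_murphy T n) (gdelta (wreath_incl u)).
Proof.
rewrite /GRing.comm jucys_murphyE mulr_suml mulr_sumr.
rewrite [RHS](reindex_inj (@perm_inj _ (wtop u))); apply: eq_bigr => i _.
rewrite mulr_suml mulr_sumr [RHS](reindex_inj (mulIg (wbase u i))).
by apply: eq_bigr => y _; rewrite -!gdeltaM jm_term_incl.
Qed.

Lemma class_last_comm (C : {set T}) (u : wreath T n) :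
  GRing.comm (class_last n C) (gdelta (wreath_incl u)).
Proof.
rewrite /GRing.comm /class_last mulr_suml mulr_sumr; apply: eq_bigr => x _.
rewrite -!gdeltaM; congr gdelta; apply: wreath_eq => [j|]; last by rewrite /= mul1g mulg1.
have baseM (U V : wreath T n.+1) : wbase (U * V)%g j = (wbase U j * wbase V (wtop U j))%g.
  by rewrite ffunE.
rewrite baseM [RHS]baseM.
case: (unliftP ord_max j) => [i|] ->.
  rewrite wtop_incl_lift wbase_incl_lift !ffunE !perm1 liftK.
  by rewrite ![lift ord_max _ == ord_max]eq_sym !(negbTE (neq_lift _ _)) mul1g mulg1.
by rewrite wtop_incl_max wbase_incl_max !ffunE perm1 unlift_none eqxx mul1g mulg1.
Qed.

Lemma gcoefJ (gT : finGroupType) (a : 'M[algC]_(gcard [set: gT])) (v w : gT) :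
    gspan [set: gT] a -> GRing.comm a (gdelta v) -> gcoef (w ^ v)%g a = gcoef w a.
Proof.
move=> Sa cav.
have conjE b : gspan [set: gT] b ->
    gcoef (w ^ v)%g (gdelta v^-1%g * (b * gdelta v)) = gcoef w b.
  elim=> [|x g {}b _ _ IH]; first by rewrite mul0r mulr0 !linear0.
  rewrite mulrDl mulrDr !linearD /= IH; congr (_ + _).
  rewrite !(galg_scalel, galg_scaler) !linearZ /= -!gdeltaM !gcoef_delta.
  by rewrite -conjgE (inj_eq (@conjg_inj _ v)).
by rewrite -[RHS]conjE // cav mulrA -gdeltaM mulVg gdelta1 mul1r.
Qed.

Definition jm_restr k (C : {set T}) (g : wreath T n) : algC :=
  gcoef (wreath_incl g) (jucys_murphy T n ^+ k * class_last n C).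

Lemma jm_restrJ k C g u : jm_restr k C (g ^ u)%g = jm_restr k C g.
Proof.
have inclV : wreath_incl u^-1%g = (wreath_incl u)^-1%g.
  apply/eqP; rewrite eq_sym eq_invg_mul -wreath_inclM mulgV.
  apply/eqP/wreath_eq => [j|]; last by rewrite /= lift_perm1.
  by rewrite !ffunE; case: (unlift _ _) => // i; rewrite ffunE.
rewrite /jm_restr !conjgE !wreath_inclM inclV -conjgE gcoefJ //.
  apply: (@gspanM _ [set: wreath T n.+1]%G).
    apply: (@gspanX _ [set: wreath T n.+1]%G); apply: gspan_sum => i _.
    by apply: gspan_sum => y _; apply: gspan_delta; rewrite inE.
  by apply: gspan_sum => x _; apply: gspan_delta; rewrite inE.
apply/commr_sym/commrM; last exact/commr_sym/class_last_comm.
exact/commrX/commr_sym/jucys_murphy_comm.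
Qed.

End CentralElement.
(** Against a class function, an induced class function is integrated on the
    subgroup only. *)
Lemma cfInd_sum (gT : finGroupType) (G H : {group gT}) (phi : 'CF(H)) (Z : gT -> algC) :
    H \subset G -> (forall x y, y \in G -> Z (x ^ y)%g = Z x) ->
  \sum_(x in G) Z x * 'Ind[G] phi x
    = #|G|%:R / #|H|%:R * \sum_(x in H) Z x * phi x.
Proof.
move=> sHG ZJ.
transitivity (#|H|%:R^-1 * \sum_(y in G) \sum_(x in G) Z x * phi (x ^ y)%g).
  rewrite exchange_big mulr_sumr; apply: eq_bigr => x Gx /=.
  by rewrite cfIndE // -mulr_sumr mulrCA.
rewrite (eq_bigr (fun=> \sum_(x in H) Z x * phi x)) => [|y Gy].
  by rewrite sumr_const mulrnAr -[LHS]mulr_natl mulrA.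
rewrite (reindex_inj (@conjg_inj _ y^-1)%g) /=.
rewrite (eq_bigl [in G]) => [|x]; last by rewrite groupJr ?groupV.
rewrite (big_setID H) /= (setIidPr sHG) [X in _ + X]big1 => [|x].
  rewrite addr0; apply: eq_bigr => x _.
  by rewrite ZJ ?groupV // conjgKV.
by case/setDP=> _ nHx; rewrite conjgKV cfun0 // mulr0.
Qed.

Section BlockCharacter.
Variables (T : finGroupType) (n : nat) (lam : multidiagram T n).
Local Notation Iz := (Iirr [set: T]).
Local Notation m z := (boxes (lam z)).
Local Notation K := (block_prod lam).
Implicit Types h u : K.

Definition block_coef h : algC := \prod_z @symmetrizer_coef (lam z) (wtop (h z)).

(** The first factor is the character of the tensor powers alone. *)
Lemma block_charE h : block_char lam h
  = color_trace (block_color lam) (block_emb h)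
    * \prod_z cfRepr (specht_repr (lam z)) (wtop (h z)).
Proof.
rewrite color_trace_block -big_split /block_char prod_cfunE ?inE //=.
apply: eq_bigr => z _; rewrite !cfunE !inE !mulr1n /= mxtrace_prod.
by [].
Qed.

Lemma color_trace_blockJ h u :
  color_trace (block_color lam) (block_emb (h ^ u)%g)
    = color_trace (block_color lam) (block_emb h).
Proof.
rewrite !color_trace_block; apply: eq_bigr => z _.
have -> : (h ^ u)%g z = (h z ^ u z)%g by rewrite !conjgE !ffunE.
have trE (w : wreath T (m z)) :
    \tr (tpow_repr (m z) 'Chi_z w) = cfRepr (tpow_repr (m z) 'Chi_z) w.
  by rewrite cfunE inE mulr1n.
by rewrite !trE cfunJ ?inE.
Qed.

Lemma sum_wreath_top N (F : 'S_N -> algC) :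
  \sum_(w : wreath T N) F (wtop w) = #|{ffun 'I_N -> T}|%:R * \sum_s F s.
Proof.
rewrite (reindex (@pair_wreath T N)) /=; last first.
  by exists (@wreath_pair T N) => [[f s]|w] //= _; case: w.
rewrite -(pair_bigA _ (fun _ s => F s)) /= sumr_const mulr_natl.
by [].
Qed.

Lemma specht_conj_sum z (w : wreath T (m z)) :
  \sum_(v : wreath T (m z)) @symmetrizer_coef (lam z) (wtop (w ^ v)%g)
    = (\sum_(v : wreath T (m z)) 1)
      * (cfRepr (specht_repr (lam z)) (wtop w) / (specht_dim (lam z))%:R).
Proof.
have topJ v : wtop (w ^ v)%g = (wtop w ^ wtop v)%g by rewrite !conjgE !wtopM.
under eq_bigr => v _ do rewrite topJ.
rewrite (sum_wreath_top (fun s => @symmetrizer_coef (lam z) (wtop w ^ s)%g)).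
rewrite (sum_wreath_top (fun=> 1)) -mulrA; congr (_ * _).
rewrite sumr_const; apply: (mulfI (specht_dim_neq0 (lam z))).
rewrite -specht_class_average mulrCA [_ / _]mulrC mulVKf ?specht_dim_neq0 //.
rewrite mulr_natl -card_Sn; congr (_ *+ _); apply: eq_card => s; rewrite !inE.
Qed.

(** Averaging over the block group replaces the product of Specht characters by
    the product of the coefficients of the Young symmetrizers. *)
Lemma block_average (Phi : K -> algC) : (forall h u, Phi (h ^ u)%g = Phi h) ->
  \sum_h Phi h * \prod_z cfRepr (specht_repr (lam z)) (wtop (h z))
    = \prod_z (specht_dim (lam z))%:R * \sum_h Phi h * block_coef h.
Proof.
move=> PhiJ; pose D := \prod_z (specht_dim (lam z))%:R : algC.
have nzD : D != 0 by apply/prodf_neq0 => z _; apply: specht_dim_neq0.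
have cardE : \prod_z \sum_(v : wreath T (m z)) 1 = #|K|%:R :> algC.
  rewrite -(sum_dffun_prod (fun z (v : wreath T (m z)) => 1)).
  transitivity (\sum_(k : K) (1 : algC)); first by apply: eq_bigr => k _; rewrite big1.
  by rewrite sumr_const.
have nzK : #|K|%:R != 0 :> algC by rewrite -cardsT neq0CG.
have avg h : \sum_u block_coef (h ^ u)%g
    = #|K|%:R * (\prod_z cfRepr (specht_repr (lam z)) (wtop (h z)) / D).
  transitivity (\sum_(u : K) \prod_z @symmetrizer_coef (lam z) (wtop (h z ^ u z)%g)).
    apply: eq_bigr => u _; apply: eq_bigr => z _; congr (symmetrizer_coef (wtop _)).
    by rewrite !conjgE !ffunE.
  rewrite (sum_dffun_prod (fun z (v : wreath T (m z)) =>
     @symmetrizer_coef (lam z) (wtop (h z ^ v)%g))).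
  under eq_bigr => z _ do rewrite specht_conj_sum.
  by rewrite big_split /= cardE -prodf_div.
apply: (mulfI nzK); rewrite -/D.
transitivity (D * \sum_h \sum_u Phi h * block_coef (h ^ u)%g).
  rewrite [LHS]mulr_sumr [RHS]mulr_sumr; apply: eq_bigr => h _.
  by rewrite -[in RHS]mulr_sumr avg; field.
rewrite [RHS]mulrCA; congr (_ * _); rewrite exchange_big /= [RHS]mulr_natl -sumr_const.
apply: eq_bigr => u _; rewrite (reindex_inj (@conjg_inj _ u^-1)%g) /=.
by apply: eq_bigr => h _; rewrite PhiJ conjgKV.
Qed.

End BlockCharacter.
(** * The normalized character of the restricted Jucys-Murphy element *)

Section MainValue.
Variables (T : finGroupType) (n : nat) (lam : multidiagram T n).
Local Notation Iz := (Iirr [set: T]).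
Local Notation dimz z := (irr_degree (@socle_of_Iirr T [set: T]%G z)).
Local Notation m z := (boxes (lam z)).
Local Notation K := (block_prod lam).
Local Notation H := (block_emb (lam := lam) @* [set: K])%g.
Implicit Types h u : K.

(** block_coef only depends on the permutations of the blocks, which determine the
    permutation of all points; elsewhere the value is zero. *)
Definition top_coef (s : 'S_n) : algC :=
  if [pick h : K | wtop (block_emb h) == s] is Some h then block_coef h else 0.

Lemma top_coef_emb h : top_coef (wtop (block_emb h)) = block_coef h.
Proof.
rewrite /top_coef; case: pickP => [u /eqP eq_top|/(_ h)]; last by rewrite eqxx.
by apply: eq_bigr => z _; rewrite (wtop_block_emb_inj eq_top).
Qed.

Lemma top_coef_out (g : wreath T n) :
  g \notin @block_emb _ _ lam @: setT -> top_coef (wtop g) = 0.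
Proof.
rewrite /top_coef; case: pickP => // h /eqP eq_top /imsetP[].
exists [ffun z => Wreath [ffun p => wbase g (in_block p)] (wtop (h z))] => //.
apply: wreath_eq => [i|]; last first.
  rewrite -eq_top; apply/permP; apply: (@ord_block_ind _ _ lam) => z p.
  by rewrite !wtop_block_emb ffunE.
by move: i; apply: (@ord_block_ind _ _ lam) => z p; rewrite wbase_block_emb !ffunE.
Qed.

Lemma sum_block_emb (G : wreath T n -> algC) :
  \sum_g G g * top_coef (wtop g) = \sum_(h : K) G (block_emb h) * block_coef h.
Proof.
rewrite (bigID [in @block_emb _ _ lam @: setT]) /= [X in _ + X]big1 => [|g].
  rewrite addr0 big_imset /=; last by move=> h u _ _; apply: block_emb_inj.
  by apply: eq_big => [h|h _]; rewrite ?inE ?top_coef_emb.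
by move/top_coef_out->; rewrite mulr0.
Qed.

Lemma wreath_char_sum (Z : wreath T n -> algC) : (forall x y, Z (x ^ y)%g = Z x) ->
  \sum_w Z w * wreath_char lam w
    = #|[set: wreath T n]|%:R / #|H|%:R * \sum_(h : K) Z (block_emb h) * block_char lam h.
Proof.
move=> ZJ; transitivity (\sum_(w in [set: wreath T n]) Z w * wreath_char lam w).
  by apply: eq_bigl => w; rewrite inE.
rewrite cfInd_sum ?subsetT //; congr (_ * _).
rewrite (eq_bigl [in @block_emb _ _ lam @: setT]) => [|w]; last by rewrite /= -morphimEdom.
rewrite big_imset /=; last by move=> h u _ _; apply: block_emb_inj.
by apply: eq_big => [h|h _]; rewrite ?inE // cfIsomE ?inE.
Qed.

Lemma block_emb1 : block_emb (1%g : K) = 1%g.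
Proof. exact: (morph1 (block_emb_morphism lam)). Qed.

Lemma xcfun_wreath_restr (chi : 'CF([set: wreath T n])) (A : walg T n.+1) :
  (chi.[wreath_restr A])%CF = \sum_w gcoef (wreath_incl w) A * chi w.
Proof.
rewrite /wreath_restr raddf_sum; apply: eq_bigr => w _ /=.
by rewrite xcfunZr xcfunG ?inE.
Qed.

Lemma color_trace1_neq0 : color_trace (block_color lam) 1%g != 0.
Proof.
rewrite -block_emb1 color_trace_block; apply/prodf_neq0 => z _.
rewrite ffunE repr_mx1 mxtrace1 pnatr_eq0 card_ffun !card_ord -lt0n expn_gt0.
by rewrite irr_degree_gt0.
Qed.

Lemma block_char1 : block_char lam 1%g
  = color_trace (block_color lam) 1%g * \prod_z (specht_dim (lam z))%:R.
Proof.
rewrite block_charE block_emb1; congr (_ * _); apply: eq_bigr => z _.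
by rewrite ffunE cfRepr1.
Qed.

Lemma specht_dims_neq0 : \prod_z (specht_dim (lam z))%:R != 0 :> algC.
Proof. by apply/prodf_neq0 => z _; apply: specht_dim_neq0. Qed.

(** Within the block of z, block_coef is the coefficient function of the Young
    symmetrizer of lam z; the other blocks are not moved and contribute 1. *)
Lemma color_step_block z k (m_z : atomic_measure) : is_transition_measure (lam z) m_z ->
  iter k (color_step (fun i => block_color lam i == z)) (lift_fun top_coef) 1%g
    = moment m_z k.
Proof.
move=> mP; rewrite (eq_iter_color_step _ _ _ (fun i => esym (codom_in_block lam z i))).
rewrite (@color_step_transport _ _ _ top_coef (@symmetrizer_coef (lam z))
           (@in_block_inj _ _ lam z) _ k 1%g).
- by rewrite color_step_symmetrizer (jucys_moment_transition mP).
- move=> t s [st s_out].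
  pose h : K := [ffun z' => dfwith (fun z' => 1%g : wreath T (m z'))
                   (Wreath [ffun=> 1%g] t : wreath T (m z)) z'].
  have -> : s = wtop (block_emb h).
    apply/permP; apply: (@ord_block_ind _ _ lam) => z' p; rewrite wtop_block_emb ffunE.
    have [eq_z|ne_z] := eqVneq z z'.
      by case: z' / eq_z p => p; rewrite dfwith_in st.
    rewrite dfwith_out // perm1 s_out // codom_in_block /block_color of_blockK.
    by rewrite eq_sym.
  rewrite top_coef_emb /block_coef (bigD1 z) //= ffunE dfwith_in big1 ?mulr1 // => z' ne_z.
  by rewrite ffunE dfwith_out 1?eq_sym // symmetrizer_coef1.
by split=> *; rewrite !perm1.
Qed.

(** Induction reduces the normalized character to a sum over the block group, where
    the Specht characters may be replaced by symmetrizer coefficients; the sum then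
    extends to the whole group and is computed on tensors. *)
Lemma wreath_char_jm k (C : {set T}) (tm : Iz -> atomic_measure) :
    (forall z, is_transition_measure (lam z) (tm z)) ->
  ((wreath_char lam).[wreath_restr (jucys_murphy T n ^+ k *m class_last n C)])%CF
      / wreath_char lam 1%g
    = \sum_z (dimz z)%:R / #|T|%:R * (#|T|%:R / (dimz z)%:R) ^+ k * moment (tm z) k
        * \sum_(x in C) 'chi_z x.
Proof.
move=> tmP; rewrite mulmxE xcfun_wreath_restr.
rewrite (wreath_char_sum (Z := jm_restr k C)); last by move=> x y; apply: jm_restrJ.
have -> : wreath_char lam 1%g
    = #|[set: wreath T n]|%:R / #|H|%:R * block_char lam 1%g.
  have := @wreath_char_sum (fun w => (w == 1%g)%:R) _.
  rewrite (bigD1 1%g) //= eqxx mul1r big1 ?addr0 => [|w /negbTE->]; last by rewrite mul0r.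
  move=> -> => [|x y]; last by rewrite conjg_eq1.
  rewrite (bigD1 1%g) //= block_emb1 eqxx mul1r big1 ?addr0 // => h /negbTE ne_h.
  by rewrite -block_emb1 (inj_eq (@block_emb_inj _ _ lam)) ne_h mul0r.
rewrite -mulf_div divff ?mul1r; last first.
  by rewrite mulf_neq0 ?invr_eq0 ?neq0CG.
under eq_bigr => h _ do rewrite block_charE mulrA.
rewrite (block_average (Phi := fun h => jm_restr k C (block_emb h)
   * color_trace (block_color lam) (block_emb h))) => [|h u]; last first.
  by rewrite color_trace_blockJ (morphJ (block_emb_morphism lam)) ?inE // jm_restrJ.
rewrite -(sum_block_emb (fun g => jm_restr k C g * color_trace (block_color lam) g)).
have -> : \sum_g jm_restr k C g * color_trace (block_color lam) g * top_coef (wtop g)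
    = color_trace (block_color lam) 1%g * \sum_z
        (dimz z)%:R / #|T|%:R * (#|T|%:R / (dimz z)%:R) ^+ k * moment (tm z) k
        * \sum_(x in C) 'chi_z x.
  transitivity (\sum_g jm_restr k C g
      * (top_coef (wtop g) * color_trace (block_color lam) g)).
    by apply: eq_bigr => g _; rewrite -mulrA [X in _ * X]mulrC.
  rewrite color_trace_jm; congr (_ * _); apply: eq_bigr => z _.
  by rewrite (color_step_block _ (tmP z)).
rewrite block_char1; have := color_trace1_neq0; have := specht_dims_neq0.
move: (color_trace _ _) (\prod_z _) (\sum_z _) => a b c nzb nza.
by field; rewrite nza nzb.
Qed.

End MainValue.

Theorem theorem1p1 (T : finGroupType) (n : nat) (lam : multidiagram T n)
    (k : nat) (tm : Iirr [set: T] -> atomic_measure)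
    (n_gt0 : (0 < n)%N) (k_gt0 : (0 < k)%N)
    (tmP : forall zeta, is_transition_measure (lam zeta) (tm zeta)) :
  let chi := wreath_char lam in
  let nchi (C : {set T}) :=
    chi.[wreath_restr (jucys_murphy T n ^+ k *m class_last n C)]%CF
      / chi 1%g in
  (forall zeta : Iirr [set: T],
     moment (tm zeta) k =
       'chi_zeta 1%g ^+ k.-1 / #|T|%:R ^+ k
       * \sum_(C in classes [set: T]) nchi C * ('chi_zeta (repr C))^* )
  /\
  (forall C : {set T}, C \in classes [set: T] ->
     nchi C =
       #|T|%:R ^+ k.-1 * #|C|%:R
       * \sum_(zeta : Iirr [set: T])
           moment (tm zeta) k * 'chi_zeta (repr C) / 'chi_zeta 1%g ^+ k.-1).
Proof.
case: k k_gt0 => // k _ chi nchi; rewrite [k.+1.-1]/=.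
have nzT : #|T|%:R != 0 :> algC by rewrite -cardsT neq0CG.
have class_sum z C : C \in classes [set: T] ->
    \sum_(x in C) 'chi[[set: T]]_z x = #|C|%:R * 'chi_z (repr C).
  case/imsetP=> x _ ->; rewrite mulr_natl -sumr_const; apply: eq_bigr => y.
  have [u _ ->] := repr_class [set: T]%G x.
  by case/imsetP=> v _ ->; rewrite !cfunJ ?inE.
have nchiE C : C \in classes [set: T] -> nchi C = #|T|%:R ^+ k * #|C|%:R
    * \sum_z moment (tm z) k.+1 * 'chi_z (repr C) / 'chi_z 1%g ^+ k.
  move=> classC; rewrite /nchi /chi (wreath_char_jm _ _ tmP) mulr_sumr.
  apply: eq_bigr => z _; rewrite class_sum // Chi1; have nzd := dimz_neq0 z.
  by rewrite exprS expr_div_n; field; rewrite nzT nzd expf_neq0.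
split=> // z; have nzz : 'chi[[set: T]]_z 1%g != 0 by apply: irr1_neq0.
have orth z' : \sum_(C in classes [set: T])
      #|C|%:R * ('chi[[set: T]]_z' (repr C) * ('chi_z (repr C))^* ) = #|T|%:R * (z' == z)%:R.
  rewrite -(sum_by_classes (F := fun x => 'chi[[set: T]]_z' x * ('chi_z x)^* )).
    by rewrite -cfdot_irr cfdotE cardsT mulrA mulfV ?mul1r.
  by move=> x y Tx Ty; rewrite !cfunJ.
rewrite (eq_bigr (fun C : {set T} =>
   \sum_z' #|T|%:R ^+ k * (moment (tm z') k.+1 / 'chi_z' 1%g ^+ k)
   * (#|C|%:R * ('chi_z' (repr C) * ('chi_z (repr C))^* )))) => [|C classC]; last first.
  by rewrite nchiE // mulr_sumr mulr_suml; apply: eq_bigr => z' _; ring.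
rewrite exchange_big /=; under eq_bigr => z' _ do rewrite -mulr_sumr orth.
rewrite (bigD1 z) //= eqxx big1 ?addr0 => [|z' /negbTE ->]; last by rewrite !mulr0.
rewrite [(true : nat)%:R]mulr1n exprS. by field; rewrite nzT !expf_neq0.
Qed.
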